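(* Let $G$ be the graph of the standard tessellation of $\mathbb{R}^n$, let $\Omega$ be a nonempty finite subset of $\mathbb{Z}^n$ and let $0\leq k\leq n-1$. Consider $\tilde\Omega$ as a weighted graph with unit weight and suppose that $C_{i_1i_2\cdots i_{k+1}}(\tilde\Omega)\neq\emptyset$ for any $1\leq i_1<i_2<\cdots<i_{k+1}\leq n$. Here $C_{i_1i_2\cdots i_{k+1}}(\tilde\Omega)$ is the set of $(k+2)$-cliques in $\tilde\Omega$ such that the $(k+1)$-simplex formed by the $k+2$ vertices of the clique is parallel to (a translate of) the $(k+1)$-simplex formed by $o,\ e_{j_1},\ e_{j_1}+e_{j_2},\ \dots,\ e_{j_1}+\cdots+e_{j_{k+1}}$ for some permutation $(j_1,\dots,j_{k+1})$ of $(i_1,\dots,i_{k+1})$, where $o$ is the origin and $\{e_1,\dots,e_n\}$ is the standard basis of $\mathbb{R}^n$. Let $T^{(k)}_{\delta d}$ and $T^{(k)}$ be the Dirichlet-to-Neumann maps of $(\tilde\Omega,\delta\Omega)$. Then $$\sum_{i=1}^{\binom{n}{k+1}}\lambda_i(T_{\delta d}^{(k)})\leq (k+1)2^{n-k-1}\sum_{1\leq i_1<i_2<\cdots<i_{k+1}\leq n}\frac{|C_{k+2}(\partial\Omega)|}{|C_{i_1i_2\cdots i_{k+1}}(\tilde\Omega)|},$$ and $$\sum_{i=1}^{\binom{n}{k+1}}\lambda_i(T^{(k)})\leq (k+1)2^{n-k-1}\sum_{1\leq i_1<i_2<\cdots<i_{k+1}\leq n}\frac{|C_{k+2}(\partial\Omega)|}{|C_{i_1i_2\cdots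 i_{k+1}}(\tilde\Omega)|}.$$ As a consequence, $$\sum_{i=1}^{\binom{n}{k+1}}\lambda_i(T_{\delta d}^{(k)})\leq\frac{n\binom{n-1}{k}2^{n-k-1}|C_{k+2}(\partial\Omega)|}{\min_{1\leq i_1<\cdots<i_{k+1}\leq n}|C_{i_1i_2\cdots i_{k+1}}(\tilde\Omega)|}$$ and $$\sum_{i=1}^{\binom{n}{k+1}}\lambda_i(T^{(k)})\leq\frac{n\binom{n-1}{k}2^{n-k-1}|C_{k+2}(\partial\Omega)|}{\min_{1\leq i_1<\cdots<i_{k+1}\leq n}|C_{i_1i_2\cdots i_{k+1}}(\tilde\Omega)|}.$$
   Context: The graph $G$ of the standard tessellation of $\mathbb{R}^n$ has $V(G)=\mathbb{Z}^n$ and $E(G)=\{\{x,y\}: x\ne y\in\mathbb{Z}^n,\ 0\le\min_{1\le i\le n}(y_i-x_i)\le\max_{1\le i\le n}(y_i-x_i)=1\}$, i.e. $x,y$ are adjacent iff one of $y-x$, $x-y$ is a nonzero vector in $\{0,1\}^n$. For $\Omega\subset V(G)$, $\delta\Omega$ is the set of vertices not in $\Omega$ that are adjacent to some vertex of $\Omega$, $\overline\Omega=\Omega\cup\delta\Omega$, and $\tilde\Omega$ is the subgraph of $G$ with vertex set $\overline\Omega$ and edge set $E(\Omega,\overline\Omega)$, the edges of $G$ with one end in $\Omega$ and the other in $\overline\Omega$ (so there are no edges between vertices of $\delta\Omega$). Then $(\tilde\Omega,\delta\Omega)$ is a finite graph with boundary $\delta\Omega$ and interior $\Omega$; write $H=\tilde\Omega$,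 $B=\delta\Omega$. A $k$-clique of $H$ is a set of $k$ distinct pairwise adjacent vertices; $C_k(H)$ is the set of $k$-cliques. $C_{k}(\partial\Omega)$ is the set of $k$-cliques of $H$ with exactly one vertex in $B$ and the remaining $k-1$ vertices in $\Omega$. A $k$-form on $H$ is a skew-symmetric function $f:V(H)^{k+1}\to\mathbb{R}$ with $f(v_0,\dots,v_k)=0$ whenever $\{v_0,\dots,v_k\}\notin C_{k+1}(H)$; $A^k(H)$ is the space of $k$-forms. $d:A^k(H)\to A^{k+1}(H)$ is $d\alpha(v_0,\dots,v_{k+1})=\sum_{j}(-1)^j\alpha(v_0,\dots,\hat v_j,\dots,v_{k+1})$ if $\{v_0,\dots,v_{k+1}\}\in C_{k+2}(H)$, and $0$ otherwise. The unit weight $w$ is $w(v_0,\dots,v_k)=1$ if $\{v_0,\dots,v_k\}\in C_{k+1}(H)$ and $0$ otherwise, for all $k\ge0$. The inner product on $A^k(H)$ is $\langle\alpha,\beta\rangle=\frac1{(k+1)!}\sum_{v_0,\dots,v_k}\alpha(v_0,\dots,v_k)\beta(v_0,\dots,v_k)w(v_0,\dots,v_k)$, $\delta:A^{k+1}(H)\to A^k(H)$ is the adjoint of $d$ ($\delta=0$ on $A^0$), and $\Delta=d\delta+\delta d$. $A^k(\partial\Omega)$ is the space of functions $f:B\times\Omega^k\to\mathbb{R}$, skew-symmetric in the last $k$ variables, vanishing when $\{v_0,\dots,v_k\}\notin C_{k+1}(\partial\Omega)$, with inner product $\langle\alpha,\beta\rangle_{\partial\Omega}=\frac1{k!}\sum_{v\in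 B}\sum_{v_1,\dots,v_k\in\Omega}\alpha(v,v_1,\dots,v_k)\beta(v,v_1,\dots,v_k)w(v,v_1,\dots,v_k)$. For $\alpha\in A^{k+1}(H)$, $\mathbf{N}\alpha\in A^k(\partial\Omega)$ is $\mathbf{N}\alpha(v,v_1,\dots,v_k)=\frac{1}{w(v,v_1,\dots,v_k)}\sum_{u\in\Omega}\alpha(u,v,v_1,\dots,v_k)w(u,v,v_1,\dots,v_k)$, and for $\alpha\in A^{k-1}(H)$ ($k\ge1$), $\mathbf{D}\alpha\in A^k(\partial\Omega)$ is $\mathbf{D}\alpha(v,v_1,\dots,v_k)=\alpha(v_1,\dots,v_k)$, whenever $\{v,v_1,\dots,v_k\}\in C_{k+1}(\partial\Omega)$, $v\in B$ (and $0$ otherwise). ''$\theta=0$ in $\Omega$'' for a form $\theta\in A^k(H)$ means that $\theta$ vanishes on every $(k+1)$-clique contained in $\Omega$. For $\varphi\in A^k(\partial\Omega)$ let $E^{(k)}_{\delta d}(\varphi)$ and $E^{(k)}(\varphi)\in A^k(H)$ be any solutions $\omega$ of $\delta d\omega=0$ in $\Omega$, respectively $\Delta\omega=0$ in $\Omega$, whose restriction to $B\times\Omega^k$ is $\varphi$ (solutions exist). Then $T^{(k)}_{\delta d}(\varphi)=\mathbf{N}(dE^{(k)}_{\delta d}(\varphi))$ and $T^{(k)}(\varphi)=\mathbf{N}(dE^{(k)}(\varphi))+\mathbf{D}(\delta E^{(k)}(\varphi))$ (for $k=0$ the $\mathbf{D}\delta$ term is zero); these are independent of the choice of solutions and are nonnegative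 self-adjoint operators on $A^k(\partial\Omega)$. For a nonnegative self-adjoint operator $T$ on a finite-dimensional inner product space, $\lambda_i(T)$ is its $i$-th positive eigenvalue, in ascending order and counted with multiplicity; the statement is understood to include that the $\lambda_i$ appearing exist. *)

(* Defs.v *)
From HB Require Import structures.
From mathcomp Require Import all_boot all_order all_algebra.
From mathcomp Require Import all_fingroup finmap.
From mathcomp Require Import boolp classical_sets reals.

Set Implicit Arguments.
Unset Strict Implicit.
Unset Printing Implicit Defensive.

Import Order.TTheory GRing.Theory Num.Theory.

Local Open Scope ring_scope.

(* Finite graphs with boundary: the interior is the complement of bdry. *)

Record bgraph := BGraph {
  vertex :> finType;
  edge : rel vertex;
  edge_sym : symmetric edge;
  edge_irr : irreflexive edge;
  bdry : {set vertex}
}.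

Section Cliques.
Variable H : bgraph.

Definition cliques (m : nat) : {set {set H}} :=
  [set S : {set H} | (#|S| == m) &&
    [forall x in S, forall y in S, (x != y) ==> edge x y]].

(* C_m(∂Ω): the m-cliques with exactly one boundary vertex. *)
Definition bcliques (m : nat) : {set {set H}} :=
  [set S in cliques m | #|S :&: bdry H| == 1%N].

(* {v_0, ..., v_{m-1}} is an m-clique; in particular the v_i are distinct. *)
Definition spans_clique (m : nat) (t : m.-tuple H) : bool :=
  [set x in t] \in cliques m.

Definition spans_bclique (k : nat) (p : H * k.-tuple H) : bool :=
  (p.1 \in bdry H) && ([set x in p.1 :: p.2] \in bcliques k.+1).

Definition perm_tuple (m : nat) (s : 'S_m) (t : m.-tuple H) : m.-tuple H :=
  [tuple tnth t (s i) | i < m].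

End Cliques.

Section Forms.
Variables (R : realType) (H : bgraph).

Definition unitw (m : nat) (t : m.-tuple H) : R := (spans_clique t)%:R.

Definition cochain (k : nat) := {ffun k.+1.-tuple H -> R^o}.

(* Functions on B × Ω^k are extended by zero to V × V^k. *)
Definition bcochain (k : nat) := {ffun H * k.-tuple H -> R^o}.

Definition skew_defect (k : nat) (f : cochain k) :
    {ffun 'S_k.+1 * k.+1.-tuple H -> R^o} :=
  [ffun p => f (perm_tuple p.1 p.2) - (-1) ^+ p.1 *: f p.2].

Definition off_cliques (k : nat) (f : cochain k) : cochain k :=
  [ffun t => (~~ spans_clique t)%:R *: f t].

Definition bskew_defect (k : nat) (f : bcochain k) :
    {ffun 'S_k * (H * k.-tuple H) -> R^o} :=
  [ffun p => f (p.2.1, perm_tuple p.1 p.2.2) - (-1) ^+ p.1 *: f p.2].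

Definition boff_cliques (k : nat) (f : bcochain k) : bcochain k :=
  [ffun p => (~~ spans_bclique p)%:R *: f p].

Fact skew_defect_is_linear k : linear (@skew_defect k).
Proof.
move=> a f g; apply/ffunP=> p; rewrite !ffunE scalerDr scalerBr opprD.
by rewrite !scalerA mulrC addrACA.
Qed.
HB.instance Definition _ k := GRing.isLinear.Build R _ _ _ (@skew_defect k)
  (@skew_defect_is_linear k).

Fact off_cliques_is_linear k : linear (@off_cliques k).
Proof.
by move=> a f g; apply/ffunP=> p; rewrite !ffunE scalerDr !scalerA mulrC.
Qed.
HB.instance Definition _ k := GRing.isLinear.Build R _ _ _ (@off_cliques k)
  (@off_cliques_is_linear k).

Fact bskew_defect_is_linear k : linear (@bskew_defect k).
Proof.
move=> a f g; apply/ffunP=> p; rewrite !ffunE scalerDr scalerBr opprD.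
by rewrite !scalerA mulrC addrACA.
Qed.
HB.instance Definition _ k := GRing.isLinear.Build R _ _ _ (@bskew_defect k)
  (@bskew_defect_is_linear k).

Fact boff_cliques_is_linear k : linear (@boff_cliques k).
Proof.
by move=> a f g; apply/ffunP=> p; rewrite !ffunE scalerDr !scalerA mulrC.
Qed.
HB.instance Definition _ k := GRing.isLinear.Build R _ _ _ (@boff_cliques k)
  (@boff_cliques_is_linear k).

(* A^k(H), characterized by mem_forms. *)
Definition forms (k : nat) : {vspace cochain k} :=
  (lker (linfun (@skew_defect k)) :&: lker (linfun (@off_cliques k)))%VS.

(* A^k(∂Ω), characterized by mem_bforms. *)
Definition bforms (k : nat) : {vspace bcochain k} :=
  (lker (linfun (@bskew_defect k)) :&: lker (linfun (@boff_cliques k)))%VS.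

Lemma mem_forms (k : nat) (f : cochain k) :
  f \in forms k <->
  (forall (s : 'S_k.+1) t, f (perm_tuple s t) = (-1) ^+ s * f t) /\
  (forall t, ~~ spans_clique t -> f t = 0).
Proof.
rewrite memv_cap !memv_ker !lfunE /=; split.
  move=> /andP[/eqP /ffunP sk /eqP /ffunP off]; split=> [s t | t nt].
    by move: (sk (s, t)); rewrite !ffunE /= => /eqP; rewrite subr_eq0 => /eqP.
  by move: (off t); rewrite !ffunE nt scale1r.
move=> [sk off]; apply/andP; split; apply/eqP/ffunP=> p; rewrite !ffunE.
  by rewrite sk subrr.
by case: (boolP (spans_clique p)) => [_|/off->]; rewrite ?scale0r ?scaler0.
Qed.

Lemma mem_bforms (k : nat) (f : bcochain k) :
  f \in bforms k <->
  (forall (s : 'S_k) v t, f (v, perm_tuple s t) = (-1) ^+ s * f (v, t)) /\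
  (forall v t, ~~ spans_bclique (v, t) -> f (v, t) = 0).
Proof.
rewrite memv_cap !memv_ker !lfunE /=; split.
  move=> /andP[/eqP /ffunP sk /eqP /ffunP off]; split=> [s v t | v t nt].
    by move: (sk (s, (v, t))); rewrite !ffunE /= => /eqP;
      rewrite subr_eq0 => /eqP.
  by move: (off (v, t)); rewrite !ffunE nt scale1r.
move=> [sk off]; apply/andP; split; apply/eqP/ffunP.
  by move=> [s [v t]]; rewrite !ffunE sk subrr.
move=> [v t]; rewrite !ffunE.
by case: (boolP (spans_bclique (v, t))) => [_|/off->];
  rewrite ?scale0r ?scaler0.
Qed.

Definition ip (k : nat) (a b : cochain k) : R :=
  (k.+1)`!%:R^-1 * \sum_(t : k.+1.-tuple H) a t * b t * unitw t.

Definition d (k : nat) (a : cochain k) : cochain k.+1 :=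
  [ffun t => if spans_clique t
     then \sum_(j < k.+2) (-1) ^+ j * a [tuple tnth t (lift j i) | i < k.+1]
     else 0].

(* δ, the adjoint of d : A^k(H) -> A^{k+1}(H). *)
Definition codiff (k : nat) (a : cochain k.+1) : cochain k :=
  xget 0 (fun c : cochain k => c \in forms k /\
    forall b, b \in forms k -> ip (d b) a = ip b c).

Definition dcodiff (k : nat) : cochain k -> cochain k :=
  match k with
  | 0 => fun=> 0
  | k'.+1 => fun a => d (codiff a)
  end.

Definition laplacian (k : nat) (a : cochain k) : cochain k :=
  dcodiff a + codiff (d a).

Definition bN (k : nat) (a : cochain k.+1) : bcochain k :=
  [ffun p => if spans_bclique p
     then (unitw [tuple of p.1 :: p.2])^-1 *
          \sum_(u in ~: bdry H) a [tuple of u :: p.1 :: p.2] *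
            unitw [tuple of u :: p.1 :: p.2]
     else 0].

Definition bD (k : nat) (a : cochain k) : bcochain k.+1 :=
  [ffun p => if spans_bclique p then a p.2 else 0].

Definition bDcodiff (k : nat) : cochain k -> bcochain k :=
  match k with
  | 0 => fun=> 0
  | k'.+1 => fun a => bD (codiff a)
  end.

Lemma mem_perm_tuple (m : nat) (s : 'S_m) (t : m.-tuple H) :
  perm_tuple s t =i t.
Proof.
move=> x; apply/tnthP/tnthP=> -[i ->]; first by exists (s i); rewrite tnth_mktuple.
by exists ((s^-1)%g i); rewrite tnth_mktuple permKV.
Qed.

Lemma spans_bclique_perm (k : nat) (s : 'S_k) (v : H) (t : k.-tuple H) :
  spans_bclique (v, perm_tuple s t) = spans_bclique (v, t).
Proof.
rewrite /spans_bclique /=.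
suff -> : finset.finset [in v :: perm_tuple s t] = [set x in v :: t] by [].
by apply/finset.setP=> x; rewrite !inE mem_perm_tuple.
Qed.

Lemma spans_clique_perm (m : nat) (s : 'S_m) (t : m.-tuple H) :
  spans_clique (perm_tuple s t) = spans_clique t.
Proof.
rewrite /spans_clique.
suff -> : finset.finset [in perm_tuple s t] = [set x in t] by [].
by apply/finset.setP=> x; rewrite !inE mem_perm_tuple.
Qed.

Lemma cons_perm_tuple (m : nat) (s : 'S_m) (v : H) (t : m.-tuple H) :
  [tuple of v :: perm_tuple s t] =
  perm_tuple (lift_perm ord0 ord0 s) [tuple of v :: t].
Proof.
apply: eq_from_tnth => i; rewrite [RHS]tnth_mktuple.
case: (unliftP ord0 i) => [j|] ->; last by rewrite lift_perm_id !tnth0.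
by rewrite lift_perm_lift !tnthS tnth_mktuple.
Qed.

Lemma bN_bforms (k : nat) (a : cochain k.+1) :
  a \in forms k.+1 -> bN a \in bforms k.
Proof.
move=> /mem_forms[sk _]; apply/mem_bforms; split=> [s v t | v t nt]; last first.
  by rewrite ffunE (negbTE nt).
rewrite !ffunE spans_bclique_perm /=; case: ifP => _; last by rewrite mulr0.
rewrite cons_perm_tuple /unitw spans_clique_perm mulrCA; congr (_ * _).
rewrite mulr_sumr; apply: eq_bigr => u _.
have -> : [tuple of u :: v :: perm_tuple s t] =
    perm_tuple (lift_perm ord0 ord0 (lift_perm ord0 ord0 s))
      [tuple of u :: v :: t].
  by rewrite -!cons_perm_tuple; apply: val_inj.
by rewrite sk spans_clique_perm !odd_lift_perm mulrA.
Qed.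

Lemma bD_bforms (k : nat) (a : cochain k) :
  a \in forms k -> bD a \in bforms k.+1.
Proof.
move=> /mem_forms[sk _]; apply/mem_bforms; split=> [s v t | v t nt]; last first.
  by rewrite ffunE (negbTE nt).
rewrite !ffunE spans_bclique_perm /=; case: ifP => _; last by rewrite mulr0.
exact: sk.
Qed.

(* "θ = 0 in Ω" *)
Definition vanishes_in_interior (k : nat) (a : cochain k) : Prop :=
  forall t : k.+1.-tuple H,
    spans_clique t -> {subset t <= ~: bdry H} -> a t = 0.

(* ω is a form, L ω = 0 in Ω, and ω restricts to φ on B × Ω^k. *)
Definition extends_by (k : nat) (L : cochain k -> cochain k)
    (phi : bcochain k) (w : cochain k) : Prop :=
  [/\ w \in forms k,
      vanishes_in_interior (L w) &
      forall (v : H) (t : k.-tuple H),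
        v \in bdry H -> {subset t <= ~: bdry H} ->
        w [tuple of v :: t] = phi (v, t)].

Definition E_dd (k : nat) (phi : bcochain k) : cochain k :=
  xget 0 (extends_by (fun w => codiff (d w)) phi).

Definition E_lap (k : nat) (phi : bcochain k) : cochain k :=
  xget 0 (extends_by (@laplacian k) phi).

(* N and D take values in A^k(∂Ω) (bN_bforms, bD_bforms), so vsproj loses
   nothing; the maps are linear because N d ω and D δ ω do not depend on the
   chosen solution ω, so linfun returns the maps themselves. *)
Definition T_dd (k : nat) : 'End(subvs_of (bforms k)) :=
  linfun (fun phi : subvs_of (bforms k) =>
    vsproj (bforms k) (bN (d (E_dd (vsval phi))))).

Definition T_lap (k : nat) : 'End(subvs_of (bforms k)) :=
  linfun (fun phi : subvs_of (bforms k) =>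
    vsproj (bforms k)
      (bN (d (E_lap (vsval phi))) + bDcodiff (E_lap (vsval phi)))).

End Forms.

(* The positive eigenvalues in ascending order, each repeated according to the
   dimension of its eigenspace. *)
Definition is_pos_spectrum (R : realType) (vT : vectType R) (f : 'End(vT))
    (s : seq R) : Prop :=
  [/\ sorted <=%R s,
      all (fun a => 0 < a) s &
      forall a : R, 0 < a -> count_mem a s = \dim (passmx.leigenspace f a)].

Definition pos_eigenvalues (R : realType) (vT : vectType R) (f : 'End(vT)) :
    seq R :=
  xget [::] (is_pos_spectrum f).

(* λ_{i+1}(f) *)
Definition lambda (R : realType) (vT : vectType R) (f : 'End(vT)) (i : nat) :
    R :=
  (pos_eigenvalues f)`_i.

Section Tessellation.
Variable n : nat.

Definition cube_vec (z : 'rV[int]_n) : bool :=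
  (z != 0) && [forall i, (z 0 i == 0) || (z 0 i == 1)].

Definition adj (x y : 'rV[int]_n) : bool := cube_vec (y - x) || cube_vec (x - y).

Lemma adj_sym : symmetric adj.
Proof. by move=> x y; rewrite /adj orbC. Qed.

Lemma adj_irr : irreflexive adj.
Proof. by move=> x; rewrite /adj subrr /cube_vec eqxx. Qed.

(* An enumeration of {-1, 0, 1}^n, which contains every y - x with x, y
   adjacent. *)
Definition small_vecs : seq 'rV[int]_n :=
  [seq \row_i ((e i : nat)%:Z - 1) | e : {ffun 'I_n -> 'I_3}].

Definition vboundary (Om : {fset 'rV[int]_n}) : {fset 'rV[int]_n} :=
  [fset y in [fset (x + z)%R | x in Om, z in small_vecs]
    | (y \notin Om) && [exists x : Om, adj (val x) y]]%fset.

Lemma adj_small_vecs (x y : 'rV[int]_n) : adj x y -> y - x \in small_vecs.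
Proof.
move=> axy; have small i : [|| (y - x) 0 i == -1, (y - x) 0 i == 0
    | (y - x) 0 i == 1].
  case/orP: axy => /andP[_ /forallP/(_ i)]; first by move=> ->; rewrite orbT.
  by rewrite -(opprB y x) !mxE !eqr_oppLR oppr0 => /orP[]->; rewrite ?orbT.
apply/mapP; exists [ffun i => inord `|((y - x) 0 i + 1)%R|%N].
  by rewrite mem_enum.
apply/rowP=> i; rewrite [RHS]mxE ffunE inordK;
  by case/or3P: (small i) => /eqP->.
Qed.

Lemma vboundaryP (Om : {fset 'rV[int]_n}) (y : 'rV[int]_n) :
  reflect (y \notin Om /\ exists2 x, x \in Om & adj x y) (y \in vboundary Om).
Proof.
rewrite !inE /=; apply: (iffP andP) => [[_ /andP[nOm]]|[nOm [x Omx axy]]].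
  by case/existsP=> x axy; split=> //; exists (val x); first exact: valP.
split; last by rewrite nOm; apply/existsP; exists [` Omx]%fset.
apply/imfset2P; exists x => //; exists (y - x); first exact: adj_small_vecs.
by rewrite addrC subrK.
Qed.

Definition vclosure (Om : {fset 'rV[int]_n}) : {fset 'rV[int]_n} :=
  (Om `|` vboundary Om)%fset.

(* The edges of G with one end in Ω and the other in the closure of Ω. *)
Definition tilde_edge (Om : {fset 'rV[int]_n}) : rel (vclosure Om) :=
  fun u v => adj (val u) (val v) && ((val u \in Om) || (val v \in Om)).

Fact tilde_edge_sym Om : symmetric (@tilde_edge Om).
Proof. by move=> u v; rewrite /tilde_edge adj_sym orbC. Qed.

Fact tilde_edge_irr Om : irreflexive (@tilde_edge Om).
Proof. by move=> u; rewrite /tilde_edge adj_irr. Qed.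

Definition tilde (Om : {fset 'rV[int]_n}) : bgraph :=
  BGraph (@tilde_edge_sym Om) (@tilde_edge_irr Om)
    [set v : vclosure Om | val v \in vboundary Om].

(* o, e_{j_1}, e_{j_1} + e_{j_2}, ..., e_{j_1} + ... + e_{j_m}, translated
   by x. *)
Definition path_simplex (x : 'rV[int]_n) (j : seq 'I_n) : seq 'rV[int]_n :=
  [seq x + \sum_(l <- take m j) delta_mx 0 l | m <- iota 0 (size j).+1].

(* C_{i_1 ... i_{k+1}} of tilde Om, for I = {i_1, ..., i_{k+1}}. Since o is a
   vertex of the model simplex, the translation vector x is a vertex of the
   clique, so it may range over the vertices of tilde Om. *)
Definition dir_cliques (Om : {fset 'rV[int]_n}) (I : {set 'I_n}) :
    {set {set tilde Om}} :=
  [set S in cliques (tilde Om) #|I|.+1 |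
    [exists x : tilde Om, exists j : #|I|.-tuple 'I_n,
      perm_eq j (enum I) &&
      perm_eq [seq val v | v <- enum S] (path_simplex (val x) j)]].

(* The minimum over all (k+1)-element I. The neutral element is an upper bound
   of every #|dir_cliques Om I|, so it has no effect when k < n. *)
Definition min_dir_cliques (Om : {fset 'rV[int]_n}) (k : nat) : nat :=
  \big[minn/#|cliques (tilde Om) k.+2|]_(I : {set 'I_n} | #|I| == k.+1)
    #|dir_cliques Om I|.

End Tessellation.

(* Main.v *)
Require Import Defs.
From HB Require Import structures.
From mathcomp Require Import all_boot all_order all_algebra.
From mathcomp Require Import all_fingroup finmap.
From mathcomp Require Import boolp classical_sets reals.
From mathcomp Require Import complex.
From mathcomp Require Import ring lra zify.

Set Implicit Arguments.
Unset Strict Implicit.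
Unset Printing Implicit Defensive.

Import Order.TTheory GRing.Theory Num.Theory.

Local Open Scope ring_scope.

(* For a set I of k + 1 directions let a_I be the k-form whose value on a clique
   is the determinant of the I-coordinates of its vertices. The reflection
   u |-> a + b - u through the neighbouring vertices a, b of a clique in Ω pairs
   off the vertices completing it, so δ a_I and δ d a_I vanish in Ω: a_I solves
   both boundary problems, and for both operators T of its boundary values is
   N d a_I. Hence <T a_I, a_J> = <d a_I, d a_J>, while |T a_I|^2 = |δ d a_I|^2.
   The Gram matrix of the d a_I dominates the diagonal matrix of the
   |C_I|, because on a clique of C_I the form d a_I is +-1 and all other d a_J
   vanish. A minimax argument with T^(1/2) a_I as test vectors bounds the sum of
   the first positive eigenvalues by the sum of |δ d a_I|^2 / |C_I|. Finally,
   d a_I takes the values 0, 1, -1, and each of 1 and -1 is attained by at most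
   2^(n-k-1) completions of a given (k+1)-clique, the completion being determined
   by the parities of its coordinates outside I. *)

(** * Self-adjoint operators *)

(** The cancellation under reflection has an algebraic source: as functions [F] of the completing
    vertex, the determinants are affine for [d a_I] and linear for [a_I], and they vanish at the
    vertices already present. Hence [F (a + b - x) = F a + F b - F x = - F x]. Since [D] reads
    [δ a_I] only in Ω, the term [D δ] drops out on the test forms, and both operators obey the same
    bound. No square root of [T] is formed: the Rayleigh quotient of [T^(1/2) v] is
    [|T v|^2 / <T v, v>], and only [|T v|^2] and [<T v, v>] are ever compared. The adjoint, the
    extensions and the eigenvalue list are arbitrary choices among the objects meeting a
    specification. Existence and uniqueness, and with them linearity of [T], therefore have to be
    proved before any spectral statement applies. If [p] and [q] count the completions with values 1
    and -1, both at most [M = 2^(n-k-1)], then [(p - q)^2 <= M (p + q)]; this gives the factor [M]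
    instead of its square. The factor [k + 1] counts the interior vertices of a clique of
    [C_{k+2}(∂Ω)], any of which may be the completing one. *)

Section InnerProduct.
Import VectorInternalTheory.
Variables (R : rcfType) (V : vectType R).

Definition inner_product (ip : V -> V -> R) : Prop :=
  [/\ forall u v, ip u v = ip v u,
      forall a u v w, ip (a *: u + v) w = a * ip u w + ip v w &
      forall u, u != 0 -> 0 < ip u u].

Definition self_adjoint (ip : V -> V -> R) (f : V -> V) : Prop :=
  forall u v, ip (f u) v = ip u (f v).

Variable ip : V -> V -> R.
Hypothesis ipP : inner_product ip.

Lemma ipC u v : ip u v = ip v u. Proof. by case: ipP. Qed.

Lemma ipPl a u v w : ip (a *: u + v) w = a * ip u w + ip v w.
Proof. by case: ipP. Qed.

Lemma ip0l w : ip 0 w = 0.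
Proof. by have := ipPl (-1) 0 0 w; rewrite scaler0 addr0 mulN1r addNr. Qed.

Lemma ipDl u v w : ip (u + v) w = ip u w + ip v w.
Proof. by rewrite -[u]scale1r ipPl mul1r scale1r. Qed.

Lemma ipZl a u w : ip (a *: u) w = a * ip u w.
Proof. by rewrite -[a *: u]addr0 ipPl ip0l addr0. Qed.

Lemma ipNl u w : ip (- u) w = - ip u w.
Proof. by rewrite -scaleN1r ipZl mulN1r. Qed.

Lemma ipBl u v w : ip (u - v) w = ip u w - ip v w.
Proof. by rewrite ipDl ipNl. Qed.

Lemma ip0r w : ip w 0 = 0. Proof. by rewrite ipC ip0l. Qed.
Lemma ipDr u v w : ip w (u + v) = ip w u + ip w v.
Proof. by rewrite ipC ipDl !(ipC w). Qed.
Lemma ipZr a u w : ip w (a *: u) = a * ip w u.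
Proof. by rewrite ipC ipZl (ipC w). Qed.
Lemma ipBr u v w : ip w (u - v) = ip w u - ip w v.
Proof. by rewrite ipC ipBl !(ipC w). Qed.

Lemma ip_suml I (r : seq I) P (F : I -> V) w :
  ip (\sum_(i <- r | P i) F i) w = \sum_(i <- r | P i) ip (F i) w.
Proof.
by apply: (big_morph (fun u => ip u w)) => [u v|]; rewrite ?ipDl ?ip0l.
Qed.

Lemma ip_sumr I (r : seq I) P (F : I -> V) w :
  ip w (\sum_(i <- r | P i) F i) = \sum_(i <- r | P i) ip w (F i).
Proof. by rewrite ipC ip_suml; apply: eq_bigr => i _; rewrite ipC. Qed.

Lemma ip_gt0 u : u != 0 -> 0 < ip u u. Proof. by case: ipP => _ _; apply. Qed.

Lemma ip_ge0 u : 0 <= ip u u.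
Proof. by have [->|/ip_gt0/ltW//] := eqVneq u 0; rewrite ip0l. Qed.

Lemma ip_eq0 u : ip u u = 0 -> u = 0.
Proof. by move=> u0; apply/eqP/negPn/negP => /ip_gt0; rewrite u0 ltxx. Qed.

Lemma ip_normalize u : u != 0 ->
  ip ((Num.sqrt (ip u u))^-1 *: u) ((Num.sqrt (ip u u))^-1 *: u) = 1.
Proof.
move=> u0; have sp := ip_gt0 u0; have s0 : Num.sqrt (ip u u) != 0.
  by rewrite gt_eqF // sqrtr_gt0.
have E := sqr_sqrtr (ltW sp); rewrite ipZl ipZr.
move: (Num.sqrt _) s0 E => s s0 <-; field.
exact: s0.
Qed.

(* A complex eigenvector [a + i b] for the eigenvalue [p + i q] satisfies
   [f a = p a - q b] and [f b = q a + p b]; self-adjointness forces [q = 0]. *)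
Lemma self_adjoint_eigenvector (f : 'End(V)) :
  self_adjoint ip f -> (0 < \dim {:V})%N ->
  exists e mu, e != 0 /\ f e = mu *: e.
Proof.
move=> fsa; rewrite dimvf => d0.
pose M := lin1_mx (v2r \o f \o @r2v R V).
have fM u : v2r (f u) = v2r u *m M by rewrite mul_rV_lin1 /= v2rK.
pose toC := (real_complex R : {rmorphism R -> complex R}).
have [l rl] : exists l, root (char_poly (map_mx toC M)) l.
  apply/closed_rootP; rewrite size_char_poly.
  by case: (dim V) d0.
move: rl; rewrite -eigenvalue_root_char => /eigenvalueP[v vM v0].
pose a := r2v (map_mx (@complex.Re R) v); pose b := r2v (map_mx (@complex.Im R) v).
case: l vM => p q vM.
have fa : f a = p *: a - q *: b.
  apply: v2r_inj; rewrite fM r2vK linearB !linearZ /= !r2vK.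
  apply/rowP => j; have := congr1 (fun w : 'rV_ _ => complex.Re (w 0 j)) vM.
  rewrite !mxE; case: (v 0 j) => x y /=; rewrite mulrN => <-.
  rewrite (big_morph (@complex.Re R) (id1 := 0) (op1 := +%R)) //; last first.
    by move=> [? ?] [? ?].
  by apply: eq_bigr => i _; rewrite !mxE; case: (v 0 i) => ? ? /=; rewrite mulr0 subr0.
have fb : f b = q *: a + p *: b.
  apply: v2r_inj; rewrite fM r2vK linearD !linearZ /= !r2vK.
  apply/rowP => j; have := congr1 (fun w : 'rV_ _ => complex.Im (w 0 j)) vM.
  rewrite !mxE; case: (v 0 j) => x y /=; rewrite addrC => <-.
  rewrite (big_morph (@complex.Im R) (id1 := 0) (op1 := +%R)) //; last first.
    by move=> [? ?] [? ?].
  by apply: eq_bigr => i _; rewrite !mxE; case: (v 0 i) => ? ? /=; rewrite mulr0 add0r.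
have ab0 : (a != 0) || (b != 0).
  rewrite -negb_and; apply: contra v0 => /andP[/eqP a0 /eqP b0].
  apply/eqP/rowP => j; move: (congr1 v2r a0) (congr1 v2r b0).
  rewrite !r2vK !linear0 => /rowP/(_ j) + /rowP/(_ j); rewrite !mxE.
  by case: (v 0 j) => x y /= -> ->.
have q0 : q = 0.
  have := fsa a b; rewrite fa fb ipBl ipDr !ipZl !ipZr => E.
  have {}E : q * (ip a a + ip b b) = 0 by move: E; lra.
  have pos : 0 < ip a a + ip b b.
    by case/orP: ab0 => /ip_gt0; have := (ip_ge0 a, ip_ge0 b) => -[]; lra.
  by move/eqP: E; rewrite mulf_eq0 (gt_eqF pos) orbF => /eqP.
by case/orP: ab0 => n0; [exists a|exists b]; exists p;
  rewrite n0 ?fa ?fb q0 !scale0r ?subr0 ?add0r.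
Qed.

End InnerProduct.

(** Completeness is put as the expansion formula, from which Parseval follows without any dimension
    count. *)
Definition eigenbasis (R : rcfType) (V : vectType R) (ip : V -> V -> R)
    (f : 'End(V)) (m : nat) (e : 'I_m -> V) (mu : 'I_m -> R) : Prop :=
  [/\ forall i j, ip (e i) (e j) = (i == j)%:R,
      forall i, f (e i) = mu i *: e i &
      forall v, v = \sum_i ip v (e i) *: e i].

(** Induction on the dimension: a unit eigenvector [e0] is split off, and self-adjointness makes [f]
    preserve its orthogonal complement [U], realized as the kernel of [ip _ e0]. *)
Theorem spectral_theorem (R : rcfType) (V : vectType R) (ip : V -> V -> R)
    (f : 'End(V)) :
  inner_product ip -> self_adjoint ip f -> exists m e mu, @eigenbasis R V ip f m e mu.
Proof.
have [m] := ubnP (\dim {:V}); elim: m => // m IH in V ip f * => dimV ipP fsa.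
have [d0|d0] := posnP (\dim {:V}).
  exists 0, (fun=> 0), (fun=> 0); split=> [[]//|[]//|v].
  rewrite big_ord0; apply/eqP; rewrite -memv0.
  by move/eqP: d0; rewrite dimv_eq0 => /eqP <-; rewrite memvf.
have [e' [l [e'0 fe']]] := self_adjoint_eigenvector ipP fsa d0.
have [e0 [e01 fe0]] : exists e0, ip e0 e0 = 1 /\ f e0 = l *: e0.
  exists ((Num.sqrt (ip e' e'))^-1 *: e'); split; first exact: ip_normalize.
  by rewrite linearZ /= fe' !scalerA mulrC.
pose g : V -> R^o := fun v => ip v e0.
have glin : linear g by move=> a u v; rewrite /g (ipPl ipP).
pose gl : {linear V -> R^o} := HB.pack g (GRing.isLinear.Build R V R^o _ g glin).
pose U := lker (linfun gl).
have UP v : (v \in U) = (ip v e0 == 0) by rewrite memv_ker lfunE.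
have fU v : v \in U -> f v \in U.
  by rewrite !UP fsa fe0 (ipZr ipP) => /eqP->; rewrite mulr0.
pose W : vectType R := subvs_of U.
pose ipW (u v : W) := ip (vsval u) (vsval v).
have ipWP : inner_product ipW.
  split=> [u v|a u v w|u u0]; rewrite /ipW.
  - exact: ipC.
  - by rewrite linearP (ipPl ipP).
  - by apply: ip_gt0 => //; rewrite -(inj_eq val_inj) in u0.
(* The restriction of [f] to [U]: since [f] preserves [U], the projection changes nothing ([hE]). *)
pose h : {linear W -> W} := (vsproj U \o f \o vsval).
have hE u : vsval (linfun h u) = f (vsval u).
  by rewrite lfunE /= vsprojK // fU // subvsP.
have ltU : (\dim U < \dim {:V})%N.
  rewrite ltn_neqAle dimvS ?subvf // andbT; apply/negP => dU.
  have /eqP UT : (U == fullv)%VS by rewrite eqEdim subvf (eqP dU) leqnn.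
  by have := UP e0; rewrite UT memvf e01 oner_eq0.
have hsa : self_adjoint ipW (linfun h) by move=> u v; rewrite /ipW !hE fsa.
have [|n [e [mu [eo ev ec]]]] := IH W ipW (linfun h) _ ipWP hsa.
  by rewrite dimvf; apply: leq_trans ltU _.
pose e1 i := if unlift ord0 i is Some j then vsval (e j) else e0.
pose mu1 i := if unlift ord0 i is Some j then mu j else l.
have e10 : e1 ord0 = e0 by rewrite /e1 unlift_none.
have e1l j : e1 (lift ord0 j) = vsval (e j) by rewrite /e1 liftK.
have ee0 j : ip (vsval (e j)) e0 = 0 by apply/eqP; rewrite -UP subvsP.
exists n.+1, e1, mu1; split.
- move=> i j; case: (unliftP ord0 i) => [i'|] ->; case: (unliftP ord0 j) => [j'|] ->;
    rewrite ?e10 ?e1l ?eqxx //.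
  + by rewrite (inj_eq lift_inj) -eo.
  + by rewrite (ipC ipP) ee0.
- move=> i; rewrite /mu1 /e1; case: unliftP => // j _.
  by rewrite -hE ev linearZ.
- move=> v; rewrite big_ord_recl e10.
  have vU : v - ip v e0 *: e0 \in U.
    by rewrite UP (ipBl ipP) (ipZl ipP) e01 mulr1 subrr.
  have := congr1 vsval (ec (vsproj U (v - ip v e0 *: e0))).
  rewrite vsprojK // => /eqP; rewrite subr_eq addrC => /eqP {1}->; congr (_ + _).
  rewrite linear_sum; apply: eq_bigr => i _; rewrite linearZ /= e1l /ipW vsprojK //.
  by rewrite (ipBl ipP) (ipZl ipP) (ipC ipP e0) ee0 mulr0 subr0.
Qed.

(** Comparing coefficients in [f v = a *: v] kills those on every [e i] with [mu i != a], so the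
    remaining basis vectors span the eigenspace. *)
Lemma dim_leigenspace (R : rcfType) (V : vectType R) (ip : V -> V -> R)
    (f : 'End(V)) m (e : 'I_m -> V) (mu : 'I_m -> R) (a : R) :
  inner_product ip -> eigenbasis ip f e mu ->
  \dim (passmx.leigenspace f a) = #|[set i | mu i == a]|.
Proof.
move=> ipP [eo ev ec]; set A := [set i | mu i == a].
pose X := [tuple e (enum_val i) | i < #|A|].
have XE (i : 'I_#|A|) : X`_i = e (enum_val i) by rewrite -tnth_nth tnth_mktuple.
have freeX : free X.
  apply/freeP => k k0 i; have := congr1 (fun v => ip v (e (enum_val i))) k0.
  rewrite (ip0l ipP) (ip_suml ipP) (bigD1 i) //= big1 => [|j ji].
    by rewrite addr0 XE (ipZl ipP) eo eqxx mulr1.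
  by rewrite XE (ipZl ipP) eo (inj_eq enum_val_inj) (negbTE ji) mulr0.
suff -> : passmx.leigenspace f a = <<X>>%VS.
  by have := freeX; rewrite /free size_tuple => /eqP.
apply/eqP; rewrite eqEsubv; apply/andP; split; last first.
  apply/span_subvP => v /tnthP[i ->]; rewrite tnth_mktuple memv_ker.
  rewrite add_lfunE opp_lfunE scale_lfunE id_lfunE ev.
  by have := enum_valP i; rewrite inE => /eqP->; rewrite subrr.
apply/subvP => v; rewrite memv_ker add_lfunE opp_lfunE scale_lfunE id_lfunE.
rewrite subr_eq0 => /eqP fv; rewrite [v]ec; apply: memv_suml => i _.
have [mui|mui] := boolP (i \in A).
  by apply/memvZ/memv_span/tnthP; exists (enum_rank_in mui i);
    rewrite tnth_mktuple enum_rankK_in.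
suff -> : ip v (e i) = 0 by rewrite scale0r mem0v.
have : ip (f v) (e i) = mu i * ip v (e i).
  rewrite {1}[v]ec linear_sum (ip_suml ipP) (bigD1 i) //= big1 => [|j ji].
    by rewrite addr0 linearZ /= ev !(ipZl ipP) eo eqxx mulr1 mulrC.
  by rewrite linearZ /= ev !(ipZl ipP) eo (negbTE ji) !mulr0.
rewrite fv (ipZl ipP) => /eqP; rewrite -subr_eq0 -mulrBl mulf_eq0 subr_eq0.
by move: mui; rewrite inE eq_sym => /negbTE -> /eqP.
Qed.

(** [pos_eigenvalues] is chosen by [xget], so uniqueness is needed as well: a sorted list is
    determined by its multiplicities, and values that are not positive occur in neither list. *)
Lemma pos_eigenvaluesE (R : realType) (V : vectType R) (ip : V -> V -> R)
    (f : 'End(V)) m (e : 'I_m -> V) (mu : 'I_m -> R) :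
  inner_product ip -> eigenbasis ip f e mu ->
  pos_eigenvalues f = sort <=%R [seq mu i | i <- enum 'I_m & 0 < mu i].
Proof.
move=> ipP eb; apply: xget_unique.
  split=> [||a a0]; first by apply: sort_sorted; apply: le_total.
    by rewrite all_sort; apply/allP => _ /mapP[i + ->]; rewrite mem_filter => /andP[].
  rewrite (dim_leigenspace a ipP eb) (seq.permP (permEl (perm_sort _ _))) count_map
    count_filter.
  rewrite enumT cardE /enum_mem size_filter; apply: eq_count => i /=.
  by rewrite !inE; case: eqP => //= ->.
move=> s [ss sp sd]; apply: (sorted_eq le_trans le_anti) => //.
  by apply: sort_sorted; apply: le_total.
apply/allP => a _; rewrite /= (seq.permP (permEl (perm_sort _ _))) count_map count_filter.
have [a0|a0] := boolP (0 < a).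
  rewrite sd // (dim_leigenspace a ipP eb).
  rewrite enumT cardE /enum_mem size_filter; apply/eqP/eq_count => i /=.
  by rewrite !inE; case: eqP => //= ->.
rewrite (count_memPn _); last by apply: contra a0 => /(allP sp).
rewrite eq_sym -leqn0 leqNgt -has_count; apply/hasPn => i _ /=.
by apply: contra a0 => /andP[/eqP <-].
Qed.

(* The rows are built from the last one upwards: the next one is chosen in the
   kernel of the already chosen rows and of the remaining columns, which are at
   most [N - 1] conditions on [N] coordinates. *)
Lemma orthonormal_flag (R : rcfType) (N : nat) (g : nat -> 'cV[R]_N) :
  exists X : 'M[R]_N, X *m X^T = 1%:M /\
    forall (i : 'I_N) (j : nat), (j < i)%N -> (row i X *m g j) = 0.
Proof.
(* Row [i] of the partial matrix ends up as row [N - m + i] of the full one, whence the shifted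
   bound on [j]. *)
suff H m : (m <= N)%N -> exists X : 'M[R]_(m, N), X *m X^T = 1%:M /\
    forall (i : 'I_m) (j : nat), (j < N - m + i)%N -> (row i X *m g j) = 0.
  have [X [X1 Xg]] := H N (leqnn _); exists X; split=> // i j ji.
  by apply: Xg; rewrite subnn.
elim: m => [_|m IH mN].
  by exists 0; split=> [|[]//]; apply/matrixP => -[].
have [X [X1 Xg]] := IH (ltnW mN).
pose K := row_mx X^T (\matrix_(i < N, j < N - m.+1) g j i 0).
have : (\rank K < N)%N.
  by apply: leq_ltn_trans (rank_leq_col _) _; rewrite subnS addnC; lia.
rewrite -subn_gt0 -mxrank_ker lt0n mxrank_eq0 => /rowV0Pn[y yK y0].
have {yK} : y *m K = 0 by apply/sub_kermxP.
rewrite mul_mx_row => /eqP; rewrite row_mx_eq0 => /andP[/eqP yX /eqP yg].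
pose q : R := (y *m y^T) 0 0.
have qE : y *m y^T = q%:M by rewrite [LHS]mx11_scalar.
have q0 : 0 < q.
  have qs : q = \sum_i y 0 i ^+ 2.
    by rewrite /q mxE; apply: eq_bigr => i _; rewrite mxE.
  rewrite lt0r qs sumr_ge0 ?andbT => [|i _]; last exact: sqr_ge0.
  apply: contra y0; rewrite psumr_eq0 => [/allP z|i _]; last exact: sqr_ge0.
  apply/eqP/rowP => i; rewrite mxE; apply/eqP; rewrite -sqrf_eq0.
  exact: z (mem_index_enum i).
pose x := (Num.sqrt q)^-1 *: y.
have x1 : x *m x^T = 1%:M.
  rewrite /x linearZ /= -scalemxAl -scalemxAr qE !scale_scalar_mx; congr _%:M.
  have s0 : Num.sqrt q != 0 by rewrite gt_eqF // sqrtr_gt0.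
  move: (sqr_sqrtr (ltW q0)) s0; move: (Num.sqrt q) => s <- s0.
  by field.
have xX : x *m X^T = 0 by rewrite /x -scalemxAl yX scaler0.
exists (col_mx x X); split.
  rewrite (tr_col_mx x X) (mul_col_row x X x^T X^T) x1 xX X1 -[X in X *m x^T]trmxK
    -trmx_mul xX trmx0.
  by rewrite -scalar_mx_block.
move=> i j; case: (@split_ordP 1 m i) => i' ->.
  rewrite -[row _ _]/(row (lshift m i') (col_mx x X)) rowKu (ord1 i') /= addn0 => jN;
    rewrite row_id /x -scalemxAl.
  suff -> : y *m g j = 0 by rewrite scaler0.
  have /rowP/(_ (Ordinal jN)) := yg; rewrite !mxE => E.
  apply/matrixP => a b; rewrite !ord1 [RHS]mxE -[RHS]E mxE.
  by apply: eq_bigr => l _; rewrite mxE.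
rewrite -[row _ _]/(row (rshift 1 i') (col_mx x X)) rowKd /= => jN; apply: Xg;
  apply: leq_trans jN _; lia.
Qed.

(** * A minimax bound for sums of positive eigenvalues *)

Section KyFan.
Variables (R : realType) (V : vectType R) (ip : V -> V -> R) (f : 'End(V)).
Hypotheses (ipP : inner_product ip) (fsa : self_adjoint ip f).
Hypothesis f_ge0 : forall v, 0 <= ip (f v) v.

(* Test vectors are rotated so that the [j]-th one is orthogonal to the first
   [j] positive eigenvectors; then [|f v|^2 >= lambda_j <f v, v>] for it. *)
Theorem sum_lambda_le m (phi : 'I_m -> V) (D : 'I_m -> R) :
  (forall i, 0 < D i) ->
  (forall x : 'I_m -> R, \sum_i D i * x i ^+ 2 <=
     ip (f (\sum_i x i *: phi i)) (\sum_i x i *: phi i)) ->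
  (m <= size (pos_eigenvalues f))%N /\
  \sum_(i < m) lambda f i <= \sum_i ip (f (phi i)) (f (phi i)) / D i.
Proof.
move=> D0 Dle; have [d [e [mu eb]]] := spectral_theorem ipP fsa.
have [eo ev ec] := eb.
pose r i j := mu i <= mu j.
pose t := sort r [seq i <- enum 'I_d | 0 < mu i].
pose s := pos_eigenvalues f.
have sE : s = map mu t.
  by rewrite /s (pos_eigenvaluesE ipP eb) /t sort_map.
have ts i : (i \in t) = (0 < mu i) by rewrite mem_sort mem_filter mem_enum andbT.
have ut : uniq t by rewrite sort_uniq filter_uniq // enum_uniq.
have mu_ge0 i : 0 <= mu i.
  by have := f_ge0 (e i); rewrite ev (ipZl ipP) eo eqxx mulr1.
have fip v i : ip (f v) (e i) = mu i * ip v (e i) by rewrite fsa ev (ipZr ipP).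
have parseval u v : ip u v = \sum_i ip u (e i) * ip v (e i).
  by rewrite {1}[u]ec (ip_suml ipP); apply: eq_bigr => i _;
    rewrite (ipZl ipP) (ipC ipP (e i)).
(* With this scaling the hypothesis says that the Gram matrix of the [psi i] for [ip (f _) _]
   dominates the identity, a property that survives rotation ([w_ge1]). *)
pose psi i := (Num.sqrt (D i))^-1 *: phi i.
have sD i : Num.sqrt (D i) ^+ 2 = D i by rewrite sqr_sqrtr // ltW.
have sD0 i : Num.sqrt (D i) != 0 by rewrite gt_eqF // sqrtr_gt0.
(* Column [j] lists the coefficients of the [psi i] on the [j]-th positive eigenvector; past the
   last one it is 0 and imposes no condition. *)
pose g j : 'cV[R]_m := \col_i if insub j is Some j' then ip (psi i) (e (tnth (in_tuple t)
  j')) else 0.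
have [X [X1 Xg]] := orthonormal_flag g.
pose w i := \sum_j X i j *: psi j.
have w_ge1 i : 1 <= ip (f (w i)) (w i).
  have -> : w i = \sum_j (X i j / Num.sqrt (D j)) *: phi j.
    by apply: eq_bigr => j _; rewrite scalerA.
  apply: le_trans (Dle _); have := congr1 (fun M : 'M_m => M i i) X1.
  rewrite !mxE eqxx mulr1n => <-; apply: ler_sum => j _.
  rewrite mxE -{1}(sD j) exprMn exprVn mulrCA mulfV ?expf_neq0 // mulr1.
  by rewrite expr2.
have w_perp (i : 'I_m) j (jt : (j < size t)%N) : (j < i)%N -> ip (w i) (e (tnth (in_tuple
  t) (Ordinal jt))) = 0.
  move=> /(Xg i)/(congr1 (fun M : 'M_1 => M 0 0)); rewrite !mxE => <-.
  rewrite (ip_suml ipP); apply: eq_bigr => l _; rewrite !mxE (ipZl ipP).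
  by rewrite insubT.
(* Term by term in the eigenbasis, [k * mu j <= mu j ^+ 2] holds when [mu j = 0] or [mu j >= k]; the
   coefficients for the other eigenvalues vanish by assumption. *)
have w_lower (i : 'I_m) k : (forall j : 'I_d, 0 < mu j -> mu j < k -> ip (w i) (e j) = 0) ->
    k * ip (f (w i)) (w i) <= ip (f (w i)) (f (w i)).
  move=> H; rewrite !parseval mulr_sumr; apply: ler_sum => j _; rewrite !fip.
  have := mu_ge0 j; rewrite le0r => /orP[/eqP->|mj]; first by rewrite !mul0r mulr0.
  have [kmu|kmu] := ltP (mu j) k; first by rewrite H // !mulr0.
  rewrite -[leRHS]mulrA -[X in k * X]mulrA [k * _]mulrCA ler_pM2l // [leRHS]mulrCA
    ler_wpM2r //.
  by rewrite -expr2 sqr_ge0.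
(* Otherwise the rotated vector of index [size t] would be orthogonal to all positive eigenvectors,
   hence be killed by [f], against [w_ge1]. *)
have size_s : (m <= size t)%N.
  rewrite leqNgt; apply/negP => tm; have := w_ge1 (Ordinal tm).
  suff -> : f (w (Ordinal tm)) = 0 by rewrite (ip0l ipP) ler10.
  rewrite [f _]ec big1 // => j _; rewrite fip.
  have := mu_ge0 j; rewrite le0r => /orP[/eqP->|mj]; first by rewrite mul0r scale0r.
  have jt : (index j t < size t)%N by rewrite index_mem ts.
  have := w_perp (Ordinal tm) _ jt jt.
  by rewrite (tnth_nth j) /= nth_index ?ts // => ->; rewrite mulr0 scale0r.
rewrite -/s sE size_map; split=> //.
apply: le_trans (_ : \sum_i ip (f (w i)) (f (w i)) <= _).
  apply: ler_sum => i _.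
  have it : (i < size t)%N by apply: leq_trans size_s.
  have x0 : 'I_d by case: (t) it => [|x].
  have lE : lambda f i = mu (nth x0 t i) by rewrite /lambda -/s sE (nth_map x0).
  have l_ge0 : 0 <= lambda f i by rewrite lE.
  apply: le_trans (ler_peMr l_ge0 (w_ge1 i)) _; apply: w_lower => j mj; rewrite lE => lt_j.
  have jt : (index j t < size t)%N by rewrite index_mem ts.
  have := w_perp i _ jt; rewrite (tnth_nth x0) /= nth_index ?ts //; apply.
  (* An eigenvalue strictly below the [i]-th one stands before position [i] in the sorted list
     [t]. *)
  rewrite ltnNge; apply: contraL lt_j => ij; rewrite -leNgt.
  have r_trans : transitive r by move=> ? ? ?; apply: le_trans.
  have r_refl : reflexive r by move=> ?; apply: lexx.
  have st : sorted r t by apply: sort_sorted => ? ?; apply: le_total.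
  have := sorted_leq_nth r_trans r_refl x0 st i (index j t) it jt ij.
  by rewrite nth_index ?ts.
have -> : \sum_i ip (f (phi i)) (f (phi i)) / D i = \sum_i ip (f (psi i)) (f (psi i)).
  apply: eq_bigr => i _; rewrite linearZ (ipZl ipP) (ipZr ipP) /= -{1}(sD i).
  by rewrite mulrA -expr2 exprVn mulrC.
have fw i : f (w i) = \sum_j X i j *: f (psi j).
  by rewrite linear_sum; apply: eq_bigr => j _; rewrite linearZ.
rewrite le_eqVlt; apply/orP; left; apply/eqP.
(* The sum of squared norms is a trace, so it is unchanged by the rotation: [X^T *m X = 1]. *)
transitivity (\sum_j \sum_l (X^T *m X) j l * ip (f (psi j)) (f (psi l))).
  under eq_bigr => i _ do rewrite fw (ip_suml ipP).
  rewrite exchange_big; apply: eq_bigr => j _ /=.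
  under eq_bigr => i _ do rewrite (ipZl ipP) (ip_sumr ipP) mulr_sumr.
  rewrite exchange_big; apply: eq_bigr => l _ /=.
  rewrite mxE mulr_suml; apply: eq_bigr => i _.
  by rewrite (ipZr ipP) mxE mulrA.
rewrite (mulmx1C X1); apply: eq_bigr => j _; rewrite (bigD1 j) //= big1 => [|l lj].
  by rewrite mxE eqxx mul1r addr0.
by rewrite mxE eq_sym (negbTE lj) mul0r.
Qed.

End KyFan.

(** * Abstract Dirichlet-to-Neumann operators *)

Section SchurComplement.
Variables (R : rcfType) (V X : vectType R) (ip : V -> V -> R).
Variables (L : {linear V -> V}) (ext : {linear X -> V}) (res : {linear V -> X}).
Hypotheses (ipP : inner_product ip) (Lsa : self_adjoint ip L).
Hypotheses (L_ge0 : forall v, 0 <= ip (L v) v)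
  (L_eq0 : forall v, ip (L v) v = 0 -> L v = 0).
Hypotheses (extK : forall x, res (ext x) = x)
  (ext_perp : forall v x, res v = 0 -> ip v (ext x) = 0).

(** Let [p] project onto the vectors with zero boundary values. The compression [M] of [L] by [p] is
    self-adjoint, so every vector is a sum from its image and its kernel. The kernel part [z] of the
    right-hand side is the only obstruction; it satisfies [L (p z) = 0], is therefore orthogonal to
    that right-hand side, and so to itself. *)
Lemma dirichlet_solvable (x : X) :
  exists w, res w = x /\ L w = ext (res (L w)).
Proof.
pose p : 'End(V) := (\1 - (linfun ext \o linfun res))%VF.
have pE v : p v = v - ext (res v).
  by rewrite add_lfunE opp_lfunE id_lfunE comp_lfunE !lfunE.
have resp v : res (p v) = 0 by rewrite pE linearB /= extK subrr.
have psa : self_adjoint ip p.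
  move=> u v; have pp a b : ip (p a) b = ip (p a) (p b).
    by rewrite [p b]pE (ipBr ipP) ext_perp ?subr0.
  by rewrite pp (ipC ipP u) [RHS]pp; apply: (ipC ipP).
pose M : 'End(V) := (p \o (linfun L \o p))%VF.
have ME v : M v = p (L (p v)) by rewrite !comp_lfunE (lfunE L).
have Msa : self_adjoint ip M by move=> u v; rewrite !ME psa Lsa psa.
(* Rank-nullity gives the dimension; the intersection is trivial because [M (M u) = 0] forces
   [ip (M u) (M u) = 0]. *)
have full : (limg M + lker M)%VS = fullv.
  apply/eqP; rewrite eqEdim subvf dimv_disjoint_sum ?(addnC (\dim (limg M))).
    by rewrite -[leqLHS](limg_ker_dim M) capfv /=.
  apply/eqP; rewrite -subv0; apply/subvP => v;
    rewrite memv_cap => /andP[/memv_imgP[u _ ->]].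
  rewrite memv_ker memv0 => /eqP MMu.
  by apply/eqP; apply: (ip_eq0 ipP); rewrite Msa MMu (ip0r ipP).
have /memv_addP[_ /memv_imgP[u _ ->] [z]] : - p (L (ext x)) \in (limg M + lker M)%VS.
  by rewrite full memvf.
rewrite memv_ker => /eqP Mz yE.
have Lz : L (p z) = 0 by apply: L_eq0; rewrite -psa -ME Mz (ip0l ipP).
have z0 : z = 0.
  apply: (ip_eq0 ipP); have -> : ip z z = ip (- p (L (ext x))) z.
    by rewrite yE (ipDl ipP) Msa Mz (ip0r ipP) add0r.
  by rewrite (ipNl ipP) psa Lsa Lz (ip0r ipP) oppr0.
exists (ext x + p u); rewrite linearD /= extK resp addr0; split=> //.
apply/eqP; rewrite -subr_eq0 -pE linearD /= linearD /= -ME.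
by rewrite z0 addr0 in yE; rewrite -yE subrr.
Qed.

Variable f : X -> X.
Hypothesis fP : forall x, exists w, res w = x /\ L w = ext (f x).

Let ipX x y := ip (ext x) (ext y).

Lemma boundary_inner_product : inner_product ipX.
Proof.
split=> [u v|a u v w|u u0]; rewrite /ipX.
- exact: ipC.
- by rewrite linearP (ipPl ipP).
- by apply: (ip_gt0 ipP); apply: contra u0 => /eqP e0; rewrite -[u]extK e0 linear0.
Qed.

(** [v - ext (res v)] has zero boundary values, hence is orthogonal to everything extended from the
    boundary. *)
Let green y v : ip (ext y) (ext (res v)) = ip (ext y) v.
Proof.
apply/esym/eqP; rewrite -subr_eq0 -(ipBr ipP) (ipC ipP) ext_perp //.
by rewrite linearB /= extK subrr.
Qed.

(** Zero boundary values give zero energy, [ip (L w) w = ip (ext y) (ext (res w)) = 0], and then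
    [L w = 0]. The solution itself need not be unique; its Neumann data are. *)
Let eq0_of_res w y : res w = 0 -> L w = ext y -> y = 0.
Proof.
move=> w0 Lw; have Lw0 : L w = 0.
  by apply: L_eq0; rewrite Lw -green w0 linear0 (ip0r ipP).
by rewrite -[y]extK -Lw Lw0 linear0.
Qed.

Lemma neumann_data_unique w y : L w = ext y -> f (res w) = y.
Proof.
move=> Lw; have [w' [rw Lw']] := fP (res w).
apply/eqP; rewrite -subr_eq0; apply/eqP/(@eq0_of_res (w' - w)).
  by rewrite linearB /= rw subrr.
by rewrite !linearB /= Lw Lw'.
Qed.

(** [f] is only known to come from some choice of solutions. Combinations of solutions are again
    solutions, and uniqueness of the Neumann data makes the choice immaterial. Without this,
    [linfun f] would say nothing about [f]. *)
Lemma dtn_linear : linear f.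
Proof.
move=> a x y; have [[u [<- Lu]] [v [<- Lv]]] := (fP x, fP y).
rewrite -linearP; apply: neumann_data_unique.
by rewrite !linearP /= Lu Lv.
Qed.

(** Green's formula; it carries symmetry and positivity from [L] over to [f]. *)
Lemma dtn_form w w' y : L w = ext y -> ipX (f (res w)) (res w') = ip (L w) w'.
Proof. by move=> Lw; rewrite (neumann_data_unique Lw) /ipX green Lw. Qed.

Lemma dtn_self_adjoint : self_adjoint ipX f.
Proof.
move=> x y; have [[u [<- Lu]] [v [<- Lv]]] := (fP x, fP y).
rewrite (dtn_form _ Lu) Lsa (ipC ipP) -(dtn_form _ Lv).
exact: (ipC boundary_inner_product).
Qed.

Lemma dtn_ge0 x : 0 <= ipX (f x) x.
Proof. by have [u [<- Lu]] := fP x; rewrite (dtn_form _ Lu). Qed.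

End SchurComplement.

Lemma linfunE_of_linear (R : rcfType) (V W : vectType R) (f : V -> W) :
  linear f -> linfun f =1 f.
Proof.
move=> fl; pose g : {linear V -> W} := HB.pack f (GRing.isLinear.Build R V W _ f fl).
exact: (lfunE g).
Qed.

(** The test vectors for the minimax bound are the boundary values of the solutions [w i]. Their
    energies are those of [w i] under [L], and [f] sends them to [res (L (w i))], which has the norm
    of [L (w i)] since [L (w i)] is extended from the boundary. *)
Theorem dtn_sum_lambda_le (R : realType) (V X : vectType R) (ip : V -> V -> R)
    (L : {linear V -> V}) (ext : {linear X -> V}) (res : {linear V -> X})
    (f : X -> X) (m : nat) (w : 'I_m -> V) (D : 'I_m -> R) :
  inner_product ip -> self_adjoint ip L -> (forall v, 0 <= ip (L v) v) ->
  (forall v, ip (L v) v = 0 -> L v = 0) ->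
  (forall x, res (ext x) = x) ->
  (forall v x, res v = 0 -> ip v (ext x) = 0) ->
  (forall x, exists v, res v = x /\ L v = ext (f x)) ->
  (forall i, 0 < D i) ->
  (forall i, L (w i) = ext (res (L (w i)))) ->
  (forall x : 'I_m -> R, \sum_i D i * x i ^+ 2 <=
     ip (L (\sum_i x i *: w i)) (\sum_i x i *: w i)) ->
  (m <= size (pos_eigenvalues (linfun f)))%N /\
  \sum_(i < m) lambda (linfun f) i <= \sum_i ip (L (w i)) (L (w i)) / D i.
Proof.
move=> ipP Lsa L_ge0 L_eq0 extK ext_perp fP D0 wL Dle.
have flin := dtn_linear ipP L_eq0 extK ext_perp fP.
have fE := linfunE_of_linear flin.
pose ipX x y := ip (ext x) (ext y).
have ipXP : inner_product ipX by exact: boundary_inner_product extK.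
have Tsa : self_adjoint ipX (linfun f).
  by move=> x y; rewrite !fE; apply: (dtn_self_adjoint ipP Lsa L_eq0 extK ext_perp fP).
have T0 x : 0 <= ipX (linfun f x) x.
  by rewrite fE; apply: (dtn_ge0 ipP L_ge0 L_eq0 extK ext_perp fP).
have [|sz le] := sum_lambda_le ipXP Tsa T0 (phi := fun i => res (w i)) D0.
  move=> x; apply: le_trans (Dle x) _; rewrite le_eqVlt; apply/orP; left; apply/eqP.
  have -> : \sum_i x i *: res (w i) = res (\sum_i x i *: w i).
    by rewrite linear_sum; apply: eq_bigr => i _; rewrite linearZ.
  rewrite fE; apply/esym.
  apply: (dtn_form ipP L_eq0 extK ext_perp fP _ (y := \sum_i x i *: res (L (w i)))).
  rewrite !linear_sum; apply: eq_bigr => i _.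
  by rewrite !linearZ /= -wL.
split=> //; apply: le_trans le _; rewrite le_eqVlt; apply/orP; left; apply/eqP.
apply: eq_bigr => i _; congr (_ / _).
by rewrite fE (neumann_data_unique ipP L_eq0 extK ext_perp fP (wL i)) /ipX -wL.
Qed.

(** * Forms on a graph with boundary *)

Definition face (T : Type) (m : nat) (j : 'I_m.+1) (t : m.+1.-tuple T) : m.-tuple T :=
  [tuple tnth t (lift j i) | i < m].

Lemma face0_cons (T : Type) (m : nat) (u : T) (t : m.-tuple T) :
  face ord0 [tuple of u :: t] = t.
Proof. by apply: eq_from_tnth => i; rewrite tnth_mktuple tnthS. Qed.

(** [s'] is what [s] induces once position [j] and its image are removed, so [s] is a [lift_perm] of
    it, which fixes the sign. *)
Lemma face_perm (H : bgraph) (m : nat) (s : 'S_m.+1) (j : 'I_m.+1) :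
  exists2 s' : 'S_m, (-1) ^+ s' = (-1) ^+ s * (-1) ^+ (s j) * (-1) ^+ j :> int &
    forall t : m.+1.-tuple H, face j (perm_tuple s t) = perm_tuple s' (face (s j) t).
Proof.
have ex i : {k | s (lift j i) = lift (s j) k}.
  have := neq_lift j i; rewrite -(inj_eq (@perm_inj _ s)) => /unlift_some[k -> _].
  by exists k.
pose g i := sval (ex i); have gE i : s (lift j i) = lift (s j) (g i) by exact: svalP (ex i).
have g_inj : injective g.
  move=> i i' /(congr1 (lift (s j))); rewrite -!gE => /perm_inj; exact: lift_inj.
have sE : s = lift_perm j (s j) (perm g_inj).
  apply/permP => i; case: (unliftP j i) => [k|] ->; last by rewrite lift_perm_id.
  by rewrite lift_perm_lift permE gE.
exists (perm g_inj) => [|t].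
  rewrite [in RHS]sE lift_perm_id odd_lift_perm !signr_addb !signr_odd.
  move: (sqrr_sign int j) (sqrr_sign int (s j));
    move: ((-1 : int) ^+ j) ((-1 : int) ^+ s j) ((-1 : int) ^+ perm g_inj).
  by move=> a b c a1 b1;
    rewrite [RHS]mulrC !mulrA -expr2 a1 mul1r mulrC !mulrA -expr2 b1 mul1r.
by apply: eq_from_tnth => i; rewrite !tnth_mktuple gE permE.
Qed.

(** A permutation of sign [(-1) ^+ j]; it reduces statements about any position to statements about
    the head. *)
Lemma perm_tuple_front (H : bgraph) (m : nat) (j : 'I_m.+1) (t : m.+1.-tuple H) :
  perm_tuple (lift_perm ord0 j 1) t = [tuple of tnth t j :: face j t].
Proof.
apply: eq_from_tnth => i; rewrite tnth_mktuple.
case: (unliftP ord0 i) => [k|] ->; last by rewrite lift_perm_id tnth0.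
by rewrite lift_perm_lift tnthS tnth_mktuple perm1.
Qed.

Lemma sum_cons_tuple (A : nmodType) (T : finType) (m : nat) (F : m.+1.-tuple T -> A) :
  \sum_t F t = \sum_u \sum_(t : m.-tuple T) F [tuple of u :: t].
Proof.
rewrite pair_big /=; apply: (reindex (fun p : T * m.-tuple T => [tuple of p.1 :: p.2])).
exists (fun t => (thead t, [tuple of behead t])) => [[u t] _ | t _] /=.
  by rewrite theadE; congr (_, _); apply: val_inj.
by rewrite -tuple_eta.
Qed.

Lemma perm_tuple_inj (H : bgraph) (m : nat) (s : 'S_m) : injective (@perm_tuple H m s).
Proof.
apply: (can_inj (g := perm_tuple s^-1%g)) => t.
by apply: eq_from_tnth => i; rewrite !tnth_mktuple permKV.
Qed.

Section GraphForms.
Variables (R : realType) (H : bgraph).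
Hypothesis bdry_indep : forall u v : H, u \in bdry H -> v \in bdry H -> ~~ edge u v.

Local Notation spans t := (spans_clique (H := H) t).

Lemma spans_cliqueP m (t : m.-tuple H) :
  reflect (forall i j, i != j -> edge (tnth t i) (tnth t j)) (spans t).
Proof.
rewrite /spans_clique inE; apply: (iffP andP) => [[c /forall_inP e] i j ij|e].
  have ut : uniq t.
    by apply/card_uniqP; rewrite size_tuple -[RHS](eqP c); apply: eq_card => x;
      rewrite !inE.
  have tS l : tnth t l \in [set x in t] by rewrite inE mem_tnth.
  have /forall_inP ej := e _ (tS i); apply: (implyP (ej _ (tS j))).
  by rewrite (inj_eq (tuple_uniqP _ ut)).
have ut : uniq t.
  apply/tuple_uniqP => i j tij; apply/eqP/negPn/negP => /e.
  by rewrite tij edge_irr.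
split; first by rewrite cardsE (card_uniqP ut) size_tuple.
apply/forall_inP => x; rewrite inE => /tnthP[i ->].
apply/forall_inP => y; rewrite inE => /tnthP[j ->].
by apply/implyP => xy; apply: e; apply: contraNneq xy => ->.
Qed.

Lemma spans_uniq m (t : m.-tuple H) : spans t -> uniq t.
Proof.
move=> /spans_cliqueP e; apply/tuple_uniqP => i j tij; apply/eqP/negPn/negP => /e.
by rewrite tij edge_irr.
Qed.

Lemma spans_cons m (u : H) (t : m.-tuple H) :
  spans [tuple of u :: t] = spans t && [forall i, edge u (tnth t i)].
Proof.
apply/spans_cliqueP/andP => [e|[/spans_cliqueP e /forallP eu] i j].
  split; [apply/spans_cliqueP => i j ij|apply/forallP => i].
    have := e (lift ord0 i) (lift ord0 j); rewrite !tnthS; apply.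
    by rewrite (inj_eq lift_inj).
  by have := e ord0 (lift ord0 i) (neq_lift _ _); rewrite tnth0 tnthS.
case: (unliftP ord0 i) => [i'|] ->; case: (unliftP ord0 j) => [j'|] -> //.
- by rewrite (inj_eq lift_inj) !tnthS; apply: e.
- by move=> _; rewrite tnthS tnth0 edge_sym.
- by move=> _; rewrite tnthS tnth0.
Qed.

Lemma spans_face m (j : 'I_m.+1) (t : m.+1.-tuple H) :
  spans t -> spans (face j t).
Proof.
by rewrite -(spans_clique_perm (lift_perm ord0 j 1)) perm_tuple_front spans_cons => /andP[].
Qed.

Lemma spans_bclique_cons k (v : H) (t : k.-tuple H) :
  spans_bclique (v, t) =
  [&& v \in bdry H, spans [tuple of v :: t] & [forall i, tnth t i \notin bdry H]].
Proof.
rewrite /spans_bclique /= inE -/(spans_clique [tuple of v :: t]).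
case: (boolP (v \in bdry H)) => //= vB; apply: andb_id2l => sp.
apply/eqP/forallP => [c1 i|tO].
  apply/negP => tB; have /andP[vt _] : (v \notin t) && uniq t := spans_uniq sp.
  have /subset_leq_card : [set v; tnth t i] \subset [set x in v :: t] :&: bdry H.
    by apply/fintype.subsetP => x; rewrite !inE => /orP[]/eqP->;
      rewrite ?eqxx ?mem_tnth ?orbT ?vB ?tB.
  rewrite c1 cards2; suff -> : v != tnth t i by [].
  by apply: contraNneq vt => ->; rewrite mem_tnth.
rewrite (_ : _ :&: _ = [set v]) ?cards1 //; apply/finset.setP => x; rewrite !inE.
case: eqVneq => [->|xv] //=; apply/negP => /andP[/tnthP[i ->]].
exact/negP.
Qed.

Lemma spans_bclique_spans k (v : H) (t : k.-tuple H) :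
  spans_bclique (v, t) -> spans [tuple of v :: t].
Proof. by rewrite spans_bclique_cons => /and3P[]. Qed.

Lemma sign_perm_int m (s : 'S_m) (e : int) :
  (-1) ^+ s = e -> (-1) ^+ s = e%:~R :> R.
Proof. by move=> <-; rewrite rmorphXn rmorphN1. Qed.

(* The antisymmetrization underlying both [d] and extension from [B * V^k]. *)
Lemma alternating_skew k (g : H -> k.-tuple H -> R) (s : 'S_k.+1) (t : k.+1.-tuple H) :
  (forall (s' : 'S_k) v t', g v (perm_tuple s' t') = (-1) ^+ s' * g v t') ->
  \sum_(j < k.+1) (-1) ^+ j * g (tnth (perm_tuple s t) j) (face j (perm_tuple s t)) =
  (-1) ^+ s * \sum_(j < k.+1) (-1) ^+ j * g (tnth t j) (face j t).
Proof.
move=> gs; rewrite [in RHS](reindex_inj (@perm_inj _ s)) /= mulr_sumr.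
apply: eq_bigr => j _; have [s' /sign_perm_int es' ->] := face_perm H s j.
rewrite tnth_mktuple gs es' !rmorphM !rmorphXn !rmorphN1.
by rewrite mulrCA !mulrA -[_ * (-1) ^+ j]mulrA -expr2 sqrr_sign mulr1.
Qed.

Lemma form_skew k (a : cochain R H k) (s : 'S_k.+1) t :
  a \in forms R H k -> a (perm_tuple s t) = (-1) ^+ s * a t.
Proof. by move=> /mem_forms[]. Qed.

Lemma form_off k (a : cochain R H k) t : a \in forms R H k -> ~~ spans t -> a t = 0.
Proof. by move=> /mem_forms[_]; apply. Qed.

Lemma form_front k (a : cochain R H k) (j : 'I_k.+1) t :
  a \in forms R H k -> a [tuple of tnth t j :: face j t] = (-1) ^+ j * a t.
Proof.
move=> af; rewrite -perm_tuple_front form_skew //.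
by rewrite odd_lift_perm /= odd_perm1 addbF signr_odd.
Qed.

Lemma d_linear k : linear (@d R H k).
Proof.
move=> a f g; apply/ffunP => t; rewrite !ffunE; case: ifP => _;
  last by rewrite scaler0 addr0.
rewrite scaler_sumr -big_split /=; apply: eq_bigr => j _.
by rewrite !ffunE mulrDr mulrCA.
Qed.
HB.instance Definition _ k := GRing.isLinear.Build R _ _ _ (@d R H k) (@d_linear k).

Lemma d_forms k (a : cochain R H k) : a \in forms R H k -> d a \in forms R H k.+1.
Proof.
move=> af; apply/mem_forms; split=> [s t|t nt]; last by rewrite ffunE (negbTE nt).
rewrite !ffunE spans_clique_perm; case: ifP => _; last by rewrite mulr0.
apply: (alternating_skew (g := fun _ => a)) => s' _ t'; exact: form_skew.
Qed.

(** The explicit adjoint of [d] for unit weights. No clique condition is needed in the sum, since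
    forms vanish off cliques. *)
Definition cod k (a : cochain R H k.+1) : cochain R H k :=
  [ffun t : k.+1.-tuple H => \sum_(u : H) a [tuple of u :: t]].

Lemma cod_linear k : linear (@cod k).
Proof.
move=> a f g; apply/ffunP => t; rewrite !ffunE scaler_sumr -big_split /=.
by apply: eq_bigr => j _; rewrite !ffunE.
Qed.
HB.instance Definition _ k := GRing.isLinear.Build R _ _ _ (@cod k) (@cod_linear k).

Lemma cod_forms k (a : cochain R H k.+1) : a \in forms R H k.+1 -> cod a \in forms R H k.
Proof.
move=> af; apply/mem_forms; split=> [s t|t nt]; rewrite !ffunE ?mulr_sumr; last first.
  by rewrite big1 // => u _; rewrite (form_off af) // spans_cons (negbTE nt).
apply: eq_bigr => u _; rewrite cons_perm_tuple form_skew // odd_lift_perm.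
by [].
Qed.

Lemma ip_formE k (a b : cochain R H k) : b \in forms R H k ->
  ip a b = (k.+1)`!%:R^-1 * \sum_t a t * b t.
Proof.
move=> bf; congr (_ * _); apply: eq_bigr => t _; rewrite /unitw.
by case: (boolP (spans t)) => [_|/(form_off bf) ->]; rewrite ?mulr1 ?mulr0.
Qed.

Lemma ip_sym k (a b : cochain R H k) : ip a b = ip b a.
Proof. by congr (_ * _); apply: eq_bigr => t _; rewrite (mulrC (a t)). Qed.

(** Moving vertex [j] to the front costs two equal signs, so all [k + 2] faces contribute the same;
    the factor [k + 2] turns [1/(k+2)!] into [1/(k+1)!]. *)
Lemma ip_d k (a : cochain R H k.+1) (b : cochain R H k) :
  a \in forms R H k.+1 -> b \in forms R H k -> ip (d b) a = ip b (cod a).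
Proof.
move=> af bf; rewrite !ip_formE ?cod_forms //.
pose S := \sum_t b t * cod a t.
have -> : \sum_t d b t * a t = k.+2%:R * S.
  transitivity (\sum_(j < k.+2) \sum_t (-1) ^+ j * b (face j t) * a t).
    rewrite exchange_big; apply: eq_bigr => t _ /=; rewrite ffunE -mulr_suml.
    by case: ifP => // /negbT/(form_off af) ->; rewrite !mulr0.
  rewrite -[k.+2 in RHS]card_ord mulr_natl -sumr_const; apply: eq_bigr => j _.
  transitivity (\sum_(t : k.+2.-tuple H) b [tuple of behead t] * a t).
    rewrite [RHS](reindex_inj (@perm_tuple_inj H _ (lift_perm ord0 j 1)));
      apply: eq_bigr => t _.
    rewrite perm_tuple_front (form_front _ _ af) mulrA [_ * (-1) ^+ j]mulrC.
    by congr (_ * b _ * _); apply: val_inj.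
  rewrite sum_cons_tuple exchange_big; apply: eq_bigr => t _ /=.
  rewrite ffunE mulr_sumr; apply: eq_bigr => u _; congr (b _ * _).
  exact: val_inj.
rewrite mulrA factS natrM invfM -/S; congr (_ * _).
by rewrite mulrAC mulVf ?mul1r // pnatr_eq0.
Qed.

(** The value chosen by [xget] is forced: the difference of two adjoints is a form orthogonal to
    itself. *)
Lemma codiffE k (a : cochain R H k.+1) : a \in forms R H k.+1 -> codiff a = cod a.
Proof.
move=> af; apply: xget_unique; first by split; [exact: cod_forms|move=> b; apply: ip_d].
move=> c [cf cP]; apply/eqP; rewrite -subr_eq0; apply/eqP.
have df : c - cod a \in forms R H k by rewrite rpredB ?cod_forms.
have E : \sum_t (c - cod a) t * (c - cod a) t = 0.
  have : ip (c - cod a) c = ip (c - cod a) (cod a) by rewrite -cP // ip_d.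
  rewrite !ip_formE ?cod_forms // => /mulfI; rewrite invr_eq0 pnatr_eq0 -lt0n fact_gt0.
  move=> /(_ isT) /eqP; rewrite -subr_eq0 -sumrB => /eqP E0.
  by rewrite -[RHS]E0; apply: eq_bigr => t _; rewrite -mulrBr !ffunE.
apply/ffunP => t; rewrite [RHS]ffunE; apply/eqP.
rewrite -sqrf_eq0 expr2; move/eqP: E; rewrite psumr_eq0 => [/allP/(_ t)|i _]; last first.
  by rewrite -expr2 sqr_ge0.
by apply; rewrite mem_index_enum.
Qed.

Lemma ip_linear k (e : R) (a b c : cochain R H k) :
  ip (e *: a + b) c = e * ip a c + ip b c.
Proof.
rewrite /ip [e * _]mulrCA -mulrDr; congr (_ * _); rewrite mulr_sumr -big_split /=.
by apply: eq_bigr => t _; rewrite !ffunE !mulrDl !mulrA.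
Qed.

Lemma ip_form_ge0 k (a : cochain R H k) : 0 <= ip a a.
Proof.
rewrite mulr_ge0 ?invr_ge0 ?ler0n //; apply: sumr_ge0 => t _.
by rewrite -expr2 mulr_ge0 ?sqr_ge0 ?ler0n.
Qed.

Lemma ip_form_eq0 k (a : cochain R H k) : a \in forms R H k -> ip a a = 0 -> a = 0.
Proof.
move=> af; rewrite ip_formE // => /eqP; rewrite mulf_eq0 invr_eq0 pnatr_eq0.
rewrite -leqn0 leqNgt fact_gt0 /= psumr_eq0 => [/allP z|t _];
  last by rewrite -expr2 sqr_ge0.
apply/ffunP => t; rewrite ffunE; apply/eqP.
by rewrite -sqrf_eq0 expr2; apply: z; rewrite mem_index_enum.
Qed.

Definition restr k (a : cochain R H k) : bcochain R H k :=
  [ffun p => if spans_bclique p then a [tuple of p.1 :: p.2] else 0].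

Lemma restr_linear k : linear (@restr k).
Proof.
move=> a f g; apply/ffunP => p; rewrite !ffunE.
by case: ifP => _; rewrite ?scaler0 ?addr0.
Qed.
HB.instance Definition _ k := GRing.isLinear.Build R _ _ _ (@restr k) (@restr_linear k).

Lemma restr_bforms k (a : cochain R H k) : a \in forms R H k -> restr a \in bforms R H k.
Proof.
move=> af; apply/mem_bforms; split=> [s v t|v t nt]; rewrite !ffunE;
  last by rewrite (negbTE nt).
rewrite spans_bclique_perm; case: ifP => _; last by rewrite mulr0.
by rewrite /= cons_perm_tuple form_skew // odd_lift_perm.
Qed.

(** Antisymmetrized extension by zero: the sum runs over the position that might hold the boundary
    vertex, and for boundary forms at most one term survives. *)
Definition extend k (phi : bcochain R H k) : cochain R H k :=
  [ffun t : k.+1.-tuple H => \sum_(j < k.+1) (-1) ^+ j * phi (tnth t j, face j t)].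

Lemma extend_linear k : linear (@extend k).
Proof.
move=> a f g; apply/ffunP => t; rewrite !ffunE scaler_sumr -big_split /=.
by apply: eq_bigr => j _; rewrite !ffunE mulrDr mulrCA.
Qed.
HB.instance Definition _ k := GRing.isLinear.Build R _ _ _ (@extend k) (@extend_linear k).

Lemma bform_off k (phi : bcochain R H k) v t :
  phi \in bforms R H k -> ~~ spans_bclique (v, t) -> phi (v, t) = 0.
Proof. by move=> /mem_bforms[_]; apply. Qed.

Lemma extend_forms k (phi : bcochain R H k) :
  phi \in bforms R H k -> extend phi \in forms R H k.
Proof.
move=> pf; apply/mem_forms; split=> [s t|t nt]; rewrite !ffunE.
  apply: (alternating_skew (g := fun v t' => phi (v, t'))) => s' v t'.
  by case/mem_bforms: pf.
rewrite big1 // => j _; rewrite (bform_off pf) ?mulr0 //; apply: contra nt.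
by move=> /spans_bclique_spans; rewrite -perm_tuple_front spans_clique_perm.
Qed.

Lemma extendK k (phi : bcochain R H k) : phi \in bforms R H k -> restr (extend phi) = phi.
Proof.
move=> pf; apply/ffunP => -[v t]; rewrite !ffunE; case: ifP => [sp|/negbT/(bform_off pf)//].
rewrite big_ord_recl big1 ?addr0 => [|j _].
  by rewrite expr0 mul1r tnth0 face0_cons.
move: sp; rewrite spans_bclique_cons => /and3P[_ _ /forallP/(_ j) tj].
by rewrite (bform_off pf) ?mulr0 // spans_bclique_cons tnthS (negbTE tj).
Qed.

Lemma ip_extend_perp k (a : cochain R H k) (phi : bcochain R H k) :
  a \in forms R H k -> phi \in bforms R H k -> restr a = 0 -> ip a (extend phi) = 0.
Proof.
move=> af pf a0; rewrite ip_formE ?extend_forms // big1 ?mulr0 // => t _.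
rewrite ffunE mulr_sumr big1 // => j _.
have [sp|/(bform_off pf) ->] := boolP (spans_bclique (tnth t j, face j t));
  last by rewrite !mulr0.
have := congr1 (fun f : bcochain R H k => f (tnth t j, face j t)) a0.
rewrite !ffunE sp /= form_front // => /eqP; rewrite mulf_eq0 signr_eq0 /= => /eqP ->.
by rewrite mul0r.
Qed.

(** By [bdry_indep] a clique has at most one boundary vertex. A form vanishing on cliques in Ω thus
    lives on cliques with exactly one, where its restriction determines it. *)
Lemma extend_restr k (a : cochain R H k) :
  a \in forms R H k -> vanishes_in_interior a -> a = extend (restr a).
Proof.
move=> af a0; apply/ffunP => t; have rf := restr_bforms af.
have [sp|nsp] := boolP (spans t); last by rewrite !form_off // extend_forms.
have [tO|] := boolP [forall i, tnth t i \notin bdry H].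
  rewrite a0 // => [|x /tnthP[i ->]]; last by rewrite inE; apply/forallP: i.
  rewrite ffunE big1 // => j _.
  by rewrite (bform_off rf) ?mulr0 // spans_bclique_cons (negbTE (forallP tO j)).
rewrite negb_forall => /existsP[j]; rewrite negbK => tj.
have other i : i != j -> tnth t i \notin bdry H.
  move=> ij; apply: contraL (spans_cliqueP _ sp i j ij) => ti; exact: bdry_indep.
have bj : spans_bclique (tnth t j, face j t).
  rewrite spans_bclique_cons tj -perm_tuple_front spans_clique_perm sp /=.
  by apply/forallP => i; rewrite tnth_mktuple other // eq_sym neq_lift.
rewrite ffunE (bigD1 j) //= big1 ?addr0 => [|i ij].
  by rewrite ffunE bj /= form_front // mulrA -expr2 sqrr_sign mul1r.
by rewrite (bform_off rf) ?mulr0 // spans_bclique_cons (negbTE (other _ ij)).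
Qed.

Lemma restr_vanish k (phi : bcochain R H k) :
  phi \in bforms R H k -> vanishes_in_interior (extend phi).
Proof.
move=> pf t _ tO; rewrite ffunE big1 // => j _.
rewrite (bform_off pf) ?mulr0 // spans_bclique_cons.
by have := tO _ (mem_tnth j t); rewrite inE => /negbTE ->.
Qed.

Lemma restr_eqP k (w : cochain R H k) (phi : bcochain R H k) :
  w \in forms R H k -> phi \in bforms R H k ->
  (forall (v : H) (t : k.-tuple H), v \in bdry H -> {subset t <= ~: bdry H} ->
     w [tuple of v :: t] = phi (v, t)) <-> restr w = phi.
Proof.
move=> wf pf; split=> [E|<- v t vB tO]; last first.
  rewrite ffunE spans_bclique_cons vB /=.
  have -> /= : [forall i, tnth t i \notin bdry H].
    by apply/forallP => i; have := tO _ (mem_tnth i t); rewrite inE.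
  by rewrite andbT; case: ifP => // /negbT /(form_off wf).
apply/ffunP => -[v t]; rewrite ffunE; case: ifP => [|/negbT/(bform_off pf)//].
rewrite spans_bclique_cons => /and3P[vB _ /forallP tO]; apply: E => // x /tnthP[i ->].
by rewrite inE.
Qed.

(** The orthogonal projection onto forms carried by cliques in Ω. Placed between [cod] and [d] it
    gives a symmetric nonnegative operator whose boundary restriction is [D δ]. *)
Definition interior_part k (a : cochain R H k) : cochain R H k :=
  [ffun t : k.+1.-tuple H => [forall i, tnth t i \notin bdry H]%:R *: a t].

Lemma interior_part_linear k : linear (@interior_part k).
Proof. by move=> a f g; apply/ffunP => t; rewrite !ffunE scalerDr !scalerA mulrC. Qed.
HB.instance Definition _ k :=
  GRing.isLinear.Build R _ _ _ (@interior_part k) (@interior_part_linear k).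

Lemma interior_part_forms k (a : cochain R H k) :
  a \in forms R H k -> interior_part a \in forms R H k.
Proof.
move=> af; apply/mem_forms; split=> [s t|t nt]; rewrite !ffunE; last first.
  by rewrite (form_off af) // scaler0.
rewrite form_skew // scalerA mulrC -scalerA; congr (_ *: ((nat_of_bool _)%:R *: _)).
apply/forallP/forallP => tO i; last by rewrite tnth_mktuple.
by have := tO ((s^-1)%g i); rewrite tnth_mktuple permKV.
Qed.

Lemma ip_interior_part k (a b : cochain R H k) :
  ip (interior_part a) b = ip (interior_part a) (interior_part b).
Proof.
congr (_ * _); apply: eq_bigr => t _; rewrite !ffunE.
by case: [forall i, _]; rewrite ?scale1r ?scale0r ?mul0r.
Qed.

Lemma vanishes_interior_part k (a : cochain R H k) :
  a \in forms R H k -> vanishes_in_interior a -> interior_part a = 0.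
Proof.
move=> af a0; apply/ffunP => t; rewrite !ffunE.
case: (boolP [forall i, _]) => [tO|_]; last by rewrite scale0r.
case: (boolP (spans t)) => [sp|/(form_off af) ->]; last by rewrite scaler0.
rewrite a0 ?scaler0 // => x /tnthP[i ->]; rewrite inE; exact: (forallP tO).
Qed.

(** The sum over [u] in Ω may be taken over all vertices, because a boundary vertex [u] is not
    adjacent to the boundary vertex [v]. *)
Lemma bN_restr k (a : cochain R H k.+1) : a \in forms R H k.+1 -> bN a = restr (cod a).
Proof.
move=> af; apply/ffunP => -[v t]; rewrite !ffunE; case: ifP => // bp.
have /= sp := spans_bclique_spans bp; rewrite /unitw sp invr1 mul1r.
rewrite [RHS](bigID (mem (~: bdry H))) /= [X in _ + X]big1 ?addr0 => [|u]; last first.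
  rewrite !inE negbK => uB; apply: (form_off af); rewrite spans_cons negb_and.
  apply/orP; right; rewrite negb_forall; apply/existsP; exists ord0; rewrite tnth0.
  by apply: bdry_indep => //; move: bp; rewrite spans_bclique_cons => /andP[].
apply: eq_bigr => u _.
by case: (boolP (spans _)) => [_|/(form_off af) ->]; rewrite ?mulr1 ?mulr0.
Qed.

(** Every face of [v :: t] other than [t] still contains [v], so the cut kills all terms of [d] but
    the first. *)
Lemma bD_restr k (a : cochain R H k) :
  a \in forms R H k -> bD a = restr (d (interior_part a)).
Proof.
move=> af; apply/ffunP => -[v t]; rewrite !ffunE; case: ifP => // bp.
rewrite (spans_bclique_spans bp) /=.
move: bp; rewrite spans_bclique_cons => /and3P[vB _ tO].
rewrite big_ord_recl big1 ?addr0 => [|j _].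
  by rewrite expr0 mul1r -/(face ord0 [tuple of v :: t]) face0_cons ffunE tO scale1r.
rewrite ffunE; case: (boolP [forall i, _]) => [/forallP/(_ ord0)|_]; last first.
  by rewrite scale0r mulr0.
rewrite tnth_mktuple; have -> : lift (lift ord0 j) ord0 = ord0 by exact: val_inj.
by rewrite tnth0 vB.
Qed.

End GraphForms.

Lemma ip_form0 (R : realType) (H : bgraph) k (a : cochain R H k) : ip 0 a = 0.
Proof. by rewrite /ip big1 ?mulr0 // => t _; rewrite ffunE !mul0r. Qed.

(** * The two Dirichlet-to-Neumann maps of a graph with boundary *)

Section GraphDtN.
Variables (R : realType) (H : bgraph) (k : nat).
Hypothesis bdry_indep : forall u v : H, u \in bdry H -> v \in bdry H -> ~~ edge u v.

Let V : vectType R := subvs_of (forms R H k).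
Let X : vectType R := subvs_of (bforms R H k).

Section Perturbed.
(* [cod \o d + K] is [δd] for [K = 0]; for [K = d \o interior_part \o cod] it
   agrees with the Laplacian in the interior, and its restriction to the
   boundary is [N d + D δ]. *)
Variable K : {linear cochain R H k -> cochain R H k}.
Hypotheses (K_forms : forall a, a \in forms R H k -> K a \in forms R H k)
  (K_sa : forall a b, a \in forms R H k -> b \in forms R H k -> ip (K a) b = ip a (K b))
  (K_ge0 : forall a, a \in forms R H k -> 0 <= ip (K a) a)
  (K_eq0 : forall a, a \in forms R H k -> ip (K a) a = 0 -> K a = 0).

Let Lc : {linear cochain R H k -> cochain R H k} := (@cod R H k \o @d R H k) \+ K.
Let ipV (a b : V) : R := ip (vsval a) (vsval b).
Let LV : {linear V -> V} := vsproj (forms R H k) \o Lc \o vsval.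
Let extV : {linear X -> V} := vsproj (forms R H k) \o @extend R H k \o vsval.
Let resV : {linear V -> X} := vsproj (bforms R H k) \o @restr R H k \o vsval.

Let Lc_forms a : a \in forms R H k -> Lc a \in forms R H k.
Proof. by move=> af; rewrite rpredD ?K_forms ?cod_forms ?d_forms. Qed.

Let LVE a : vsval (LV a) = Lc (vsval a).
Proof. exact: vsprojK (Lc_forms (subvsP a)). Qed.

Let extVE x : vsval (extV x) = extend (vsval x).
Proof. exact: vsprojK (extend_forms (subvsP x)). Qed.

Let resVE a : vsval (resV a) = restr (vsval a).
Proof. exact: vsprojK (restr_bforms (subvsP a)). Qed.

Let ip_Lc a b : a \in forms R H k -> b \in forms R H k ->
  ip (Lc a) b = ip (d a) (d b) + ip (K a) b.
Proof.
move=> af bf; rewrite -[Lc a]/(cod (d a) + K a) -[cod (d a)]scale1r ip_linear mul1r.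
by rewrite ip_sym -ip_d ?d_forms // ip_sym.
Qed.

Let ipVP : inner_product ipV.
Proof.
split=> [u v|e a b c|a a0]; rewrite /ipV.
- exact: ip_sym.
- by rewrite linearP ip_linear.
- rewrite lt_neqAle ip_form_ge0 andbT eq_sym; apply: contra a0 => /eqP.
  by move/(ip_form_eq0 (subvsP a)) => a0; apply/eqP/val_inj.
Qed.

Let LV_sa : self_adjoint ipV LV.
Proof.
move=> a b; rewrite /ipV !LVE [RHS]ip_sym !ip_Lc ?subvsP // K_sa ?subvsP //.
by congr (_ + _); apply: ip_sym.
Qed.

Let LV_ge0 a : 0 <= ipV (LV a) a.
Proof. by rewrite /ipV LVE ip_Lc ?subvsP // addr_ge0 ?ip_form_ge0 ?K_ge0 ?subvsP. Qed.

Let LV_eq0 a : ipV (LV a) a = 0 -> LV a = 0.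
Proof.
rewrite /ipV LVE ip_Lc ?subvsP // => /eqP.
rewrite paddr_eq0 ?ip_form_ge0 ?K_ge0 ?subvsP // => /andP[/eqP da /eqP Ka].
apply: val_inj; rewrite /= -/(vsval _) LVE -[Lc _]/(cod (d _) + K _).
by rewrite (ip_form_eq0 _ da) ?d_forms ?subvsP // (K_eq0 _ Ka) ?subvsP // !linear0 addr0.
Qed.

Let extVK x : resV (extV x) = x.
Proof. by apply: val_inj; rewrite /= -/(vsval _) resVE extVE extendK ?subvsP. Qed.

Let extV_perp a x : resV a = 0 -> ipV a (extV x) = 0.
Proof.
move=> a0; rewrite /ipV extVE ip_extend_perp ?subvsP //.
by rewrite -resVE a0 linear0.
Qed.

(** Justifies the choice by [xget] in [E_dd] and [E_lap]. Only interior values enter the boundary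
    problem, so [Lop] may differ from the symmetric operator [Lc] at the boundary, as the Laplacian
    does. *)
Lemma extension_spec (Lop : cochain R H k -> cochain R H k) (x : X) :
  (forall w, w \in forms R H k ->
     vanishes_in_interior (Lop w) <-> vanishes_in_interior (Lc w)) ->
  let w := xget 0 (extends_by Lop (vsval x)) in
  [/\ w \in forms R H k, restr w = vsval x & Lc w = extend (restr (Lc w))].
Proof.
move=> LopE; set P := extends_by Lop (vsval x).
have [w [rw Lw]] := dirichlet_solvable ipVP LV_sa LV_eq0 extVK extV_perp x.
have : P (xget 0 P).
  apply: xgetPex; exists (vsval w); split; first exact: subvsP.
    apply/LopE; first exact: subvsP.
    by rewrite -LVE Lw extVE; apply: restr_vanish; apply: subvsP.
  by apply/restr_eqP; rewrite ?subvsP // -resVE rw.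
move: (xget _ _) => w' [w'f /LopE-/(_ w'f) w'0 /restr_eqP w'x]; split=> //.
  by apply: w'x; rewrite ?subvsP.
by apply: extend_restr; rewrite ?Lc_forms.
Qed.

(** As [K] kills the test forms, [K] is absent from their energy and from their Neumann data,
    leaving a bound in terms of [d] and [cod] alone. *)
Theorem graph_sum_lambda_le (f : X -> X) m (w : 'I_m -> cochain R H k) (D : 'I_m -> R) :
  (forall x, exists v, [/\ v \in forms R H k, restr v = vsval x &
     cod (d v) + K v = extend (vsval (f x))]) ->
  (forall i, w i \in forms R H k) -> (forall i, K (w i) = 0) ->
  (forall i, vanishes_in_interior (cod (d (w i)))) ->
  (forall i, 0 < D i) ->
  (forall x : 'I_m -> R, \sum_i D i * x i ^+ 2 <=
     ip (\sum_i x i *: d (w i)) (\sum_i x i *: d (w i))) ->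
  (m <= size (pos_eigenvalues (linfun f)))%N /\
  \sum_(i < m) lambda (linfun f) i <=
    \sum_i ip (cod (d (w i))) (cod (d (w i))) / D i.
Proof.
move=> fP wf Kw w0 D0 Dle; pose wV i : V := vsproj (forms R H k) (w i).
have wVE i : vsval (wV i) = w i by rewrite vsprojK.
have LwE i : vsval (LV (wV i)) = cod (d (w i)).
  by rewrite LVE wVE -[Lc _]/(cod (d _) + K _) Kw addr0.
have H1 x : exists v, resV v = x /\ LV v = extV (f x).
  have [v [vf vx vL]] := fP x; exists (vsproj (forms R H k) v).
  have vE : vsval (vsproj (forms R H k) v) = v by rewrite vsprojK.
  split; apply: val_inj; first by rewrite -[LHS]/(vsval (resV _)) resVE vE.
  by rewrite -[LHS]/(vsval (LV _)) -[RHS]/(vsval (extV _)) LVE extVE vE.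
have H2 i : LV (wV i) = extV (resV (LV (wV i))).
  apply: val_inj; rewrite -[LHS]/(vsval (LV _)) -[RHS]/(vsval (extV _)).
  rewrite extVE resVE LwE.
  by apply: extend_restr => //; rewrite cod_forms ?d_forms.
have [|sz le] := dtn_sum_lambda_le ipVP LV_sa LV_ge0 LV_eq0 extVK extV_perp H1 D0 H2.
  move=> x; apply: le_trans (Dle x) _; rewrite /ipV LVE ip_Lc ?subvsP //.
  have -> : vsval (\sum_i x i *: wV i) = \sum_i x i *: w i.
    by rewrite linear_sum; apply: eq_bigr => i _; rewrite linearZ /= wVE.
  have -> : K (\sum_i x i *: w i) = 0.
    by rewrite linear_sum big1 // => i _; rewrite linearZ /= Kw scaler0.
  have -> : d (\sum_i x i *: w i) = \sum_i x i *: d (w i).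
    by rewrite linear_sum; apply: eq_bigr => i _; rewrite linearZ.
  by rewrite ip_form0 addr0.
split=> //; apply: le_trans le _; apply: ler_sum => i _.
by rewrite /ipV LwE.
Qed.

End Perturbed.

Theorem T_dd_sum_lambda_le m (w : 'I_m -> cochain R H k) (D : 'I_m -> R) :
  (forall i, w i \in forms R H k) ->
  (forall i, vanishes_in_interior (cod (d (w i)))) ->
  (forall i, 0 < D i) ->
  (forall x : 'I_m -> R, \sum_i D i * x i ^+ 2 <=
     ip (\sum_i x i *: d (w i)) (\sum_i x i *: d (w i))) ->
  (m <= size (pos_eigenvalues (T_dd R H k)))%N /\
  \sum_(i < m) lambda (T_dd R H k) i <=
    \sum_i ip (cod (d (w i))) (cod (d (w i))) / D i.
Proof.
move=> wf w0 D0 Dle.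
pose K : {linear cochain R H k -> cochain R H k} := \0.
apply: (graph_sum_lambda_le (K := K)) => //; rewrite /K /=.
- by move=> a _; apply: mem0v.
- by move=> a b _ _; rewrite ip_form0 ip_sym ip_form0.
- by move=> a _; rewrite ip_form0.
move=> x.
have := @extension_spec K _ _ _ _ (fun w => codiff (d w)) x.
case=> [a _|a b _ _|a _|//|v vf|vf vx vL]; rewrite /= ?mem0v ?ip_form0 //.
- by rewrite ip_sym ip_form0.
- by rewrite codiffE ?d_forms // addr0.
rewrite -/(E_dd _) in vf vx vL.
exists (E_dd (vsval x)); split=> //.
rewrite vsprojK; first by rewrite bN_restr ?d_forms // [LHS]vL /= addr0.
by apply: bN_bforms; apply: d_forms.
Qed.

End GraphDtN.

(** Degree 0 stands apart: the correction [K] passes through forms of one degree less. *)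
Lemma T_lap0 (R : realType) (H : bgraph) : T_lap R H 0 = T_dd R H 0.
Proof.
rewrite /T_lap /T_dd; congr linfun; apply/funext => x.
rewrite /E_lap /E_dd /laplacian /= addr0;
  congr (vsproj _ (bN (d (xget 0 (extends_by _ _))))).
by apply/funext => a; rewrite add0r.
Qed.

(** The correction [K] kills [w i] exactly because [cod (w i)] vanishes in the interior. *)
Theorem T_lap_sum_lambda_le (R : realType) (H : bgraph) (k : nat)
    (bdry_indep : forall u v : H, u \in bdry H -> v \in bdry H -> ~~ edge u v)
    m (w : 'I_m -> cochain R H k.+1) (D : 'I_m -> R) :
  (forall i, w i \in forms R H k.+1) ->
  (forall i, vanishes_in_interior (cod (w i))) ->
  (forall i, vanishes_in_interior (cod (d (w i)))) ->
  (forall i, 0 < D i) ->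
  (forall x : 'I_m -> R, \sum_i D i * x i ^+ 2 <=
     ip (\sum_i x i *: d (w i)) (\sum_i x i *: d (w i))) ->
  (m <= size (pos_eigenvalues (T_lap R H k.+1)))%N /\
  \sum_(i < m) lambda (T_lap R H k.+1) i <=
    \sum_i ip (cod (d (w i))) (cod (d (w i))) / D i.
Proof.
move=> wf cw0 w0 D0 Dle.
pose K : {linear cochain R H k.+1 -> cochain R H k.+1} :=
  @d R H k \o @interior_part R H k \o @cod R H k.
have K_forms a : a \in forms R H k.+1 -> K a \in forms R H k.+1.
  by move=> af; rewrite d_forms ?interior_part_forms ?cod_forms.
have ipK a b : a \in forms R H k.+1 -> b \in forms R H k.+1 ->
    ip (K a) b = ip (interior_part (cod a)) (interior_part (cod b)).
  move=> af bf; rewrite ip_d ?interior_part_forms ?cod_forms //; apply: ip_interior_part.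
have K_sa a b : a \in forms R H k.+1 -> b \in forms R H k.+1 -> ip (K a) b = ip a (K b).
  by move=> af bf; rewrite [RHS]ip_sym !ipK // ip_sym.
have K_ge0 a : a \in forms R H k.+1 -> 0 <= ip (K a) a.
  by move=> af; rewrite ipK // ip_form_ge0.
have K_eq0 a : a \in forms R H k.+1 -> ip (K a) a = 0 -> K a = 0.
  move=> af; rewrite ipK // => /ip_form_eq0 E.
  by rewrite /K /= E ?interior_part_forms ?cod_forms // linear0.
apply: (@graph_sum_lambda_le _ _ _ bdry_indep K K_forms K_sa K_ge0 K_eq0) => // [|i];
  last first.
  by rewrite /K /= vanishes_interior_part ?cod_forms // linear0.
(* On a clique in Ω all faces lie in Ω, so cutting down to the interior has no effect there. *)
have KE (v : cochain R H k.+1) t : v \in forms R H k.+1 -> {subset t <= ~: bdry H} ->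
    (d (codiff v)) t = K v t.
  move=> vf tO; rewrite codiffE // !ffunE; case: ifP => // _.
  apply: eq_bigr => j _; rewrite !ffunE.
  have -> : [forall i, tnth [tuple tnth t (lift j i0) | i0 < k.+1] i \notin bdry H].
    by apply/forallP => i; rewrite tnth_mktuple; have := tO _ (mem_tnth (lift j i) t);
      rewrite inE.
  by rewrite scale1r.
move=> x.
have [] := @extension_spec _ _ _ bdry_indep K K_forms K_sa K_ge0 K_eq0 (@laplacian R H
  k.+1) x.
  move=> v vf; rewrite /laplacian /= (codiffE (d_forms vf)); split=> E t sp tO;
    by move: (E t sp tO); rewrite [in X in X -> _]ffunE [in X in _ -> X]ffunE KE // addrC.
rewrite -/(E_lap _) => vf vx vL.
exists (E_lap (vsval x)); split=> //.
have bf : bN (d (E_lap (vsval x))) + bDcodiff (E_lap (vsval x)) \in bforms R H k.+1.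
  by rewrite rpredD ?bN_bforms ?d_forms // -[bDcodiff _]/(bD (codiff _)) codiffE //
    bD_bforms ?cod_forms.
rewrite vsprojK // bN_restr ?d_forms // -[bDcodiff _]/(bD (codiff _)) codiffE // bD_restr
  ?cod_forms //.
by rewrite -linearD.
Qed.

(** * Determinants of cliques of the tessellation *)

Section Volume.
Variables (n m : nat) (c : 'I_m -> 'I_n).
Implicit Types (x y z : 'rV[int]_n) (v : 'I_m.+1 -> 'rV[int]_n).

Definition vol (u : 'I_m -> 'rV[int]_n) : int := \det (\matrix_(i, j) u i 0 (c j)).

Definition affine_mx (v : 'I_m.+1 -> 'rV[int]_n) : 'M[int]_m.+1 :=
  \matrix_(i, j) if unlift ord0 j is Some j' then v i 0 (c j') else 1.

(** [m!] times the signed volume of the simplex projected to the coordinates [c]; [vol] is the case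
    where the origin is added as first vertex. *)
Definition affine_vol v : int := \det (affine_mx v).

(** Expansion along the column of ones, which is the coboundary formula for [vol]. *)
Lemma affine_volE v : affine_vol v = \sum_(j < m.+1) (-1) ^+ j * vol (v \o lift j).
Proof.
rewrite /affine_vol (expand_det_col _ ord0); apply: eq_bigr => i _.
rewrite mxE unlift_none mul1r /cofactor addn0; congr (_ * \det _).
by apply/matrixP => a b; rewrite !mxE liftK.
Qed.

Lemma affine_vol_eq0 v i j : i != j -> (forall l, v i 0 (c l) = v j 0 (c l)) ->
  affine_vol v = 0.
Proof.
move=> ij E; apply: (determinant_alternate ij) => l; rewrite !mxE.
by case: unliftP => // l' _; apply: E.
Qed.

Lemma affine_vol_perm v (s : 'S_m.+1) : affine_vol (v \o s) = (-1) ^+ s * affine_vol v.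
Proof.
rewrite /affine_vol -det_perm -det_mulmx -row_permE.
by congr (\det _); apply/matrixP => i j; rewrite !mxE.
Qed.

(** The unitriangular [L] subtracts from each row the preceding one, which reduces the column of
    ones to a single 1. *)
Lemma affine_vol_steps v : affine_vol v =
  \det (\matrix_(i < m, j < m) (v (lift ord0 i) 0 (c j) - v (widen_ord (leqnSn m) i) 0 (c
    j))).
Proof.
pose L : 'M[int]_m.+1 := \matrix_(i, j) ((i == j)%:R - (i == j.+1 :> nat)%:R).
have Ltrig : is_trig_mx L.
  apply/is_trig_mxP => i j ij; rewrite mxE -val_eqE /= ltn_eqF //.
  by rewrite (ltn_eqF (ltnW _)) // subrr.
have L1 : \det L = 1.
  rewrite det_trig // big1 // => i _; rewrite mxE eqxx ltn_eqF ?subr0 //.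
have -> : affine_vol v = \det (L *m affine_mx v) by rewrite det_mulmx L1 mul1r.
have LE (w : 'I_m.+1 -> int) i : \sum_j L i j * w j =
    if unlift ord0 i is Some i' then w i - w (widen_ord (leqnSn m) i') else w i.
  under eq_bigr => j _ do rewrite mxE mulrBl.
  rewrite sumrB (bigD1 i) //= eqxx mul1r big1 ?addr0 => [|j ji]; last first.
    by rewrite eq_sym (negbTE ji) mul0r.
  case: unliftP => [i'|] ->; last first.
    by rewrite big1 ?subr0 // => j _; rewrite mul0r.
  congr (_ - _); rewrite (bigD1 (widen_ord (leqnSn m) i')) //= eqxx mul1r.
  rewrite big1 ?addr0 // => j ji; rewrite /bump /= add1n eqSS.
  by move: ji; rewrite -val_eqE /= eq_sym => /negbTE ->; rewrite mul0r.
rewrite (expand_det_col _ ord0) big_ord_recl big1 ?addr0 => [|i _].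
  rewrite mxE LE unlift_none mxE unlift_none mul1r /cofactor addn0 expr0 mul1r.
  congr (\det _); apply/matrixP => i j; rewrite [LHS]mxE [LHS]mxE mxE LE liftK.
  by rewrite !mxE liftK.
by rewrite mxE LE liftK !mxE unlift_none subrr mul0r.
Qed.

End Volume.

(** The absolute values of the terms of the determinant are among the nonnegative terms obtained by
    expanding the product of the column sums. *)
Lemma det_le1 m (E : 'M[int]_m) : (forall i j, 0 <= E i j) ->
  (forall j, \sum_i E i j <= 1) -> `|\det E| <= 1.
Proof.
move=> E0 E1; rewrite -det_tr /determinant.
apply: le_trans (ler_norm_sum _ _ _) _.
apply: le_trans (_ : \prod_j \sum_i E i j <= _); last first.
  by apply: prodr_ile1 => j _; rewrite E1 sumr_ge0.
rewrite bigA_distr_bigA /=.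
pose F (f : {ffun 'I_m -> 'I_m}) := \prod_j E (f j) j.
apply: le_trans (_ : \sum_(f in [set pval s | s : 'S_m]) F f <= _).
  rewrite big_imset /=; last by move=> s s' _ _; apply: val_inj.
  rewrite [leRHS](eq_bigl predT) /=; last by move=> s; rewrite inE.
  apply: ler_sum => s _; rewrite normrM normrX normrN1 expr1n mul1r ger0_norm.
    rewrite le_eqVlt; apply/orP; left; apply/eqP; apply: eq_bigr => j _.
    by rewrite mxE pvalE.
  by apply: prodr_ge0 => j _; rewrite mxE.
rewrite [leRHS](bigID (mem [set pval s | s : 'S_m])) /= lerDl.
by apply: sumr_ge0 => f _; apply: prodr_ge0.
Qed.

(** * The order behind adjacency: cliques as chains *)

Section CubeOrder.
Variable n : nat.
Implicit Types (x y z : 'rV[int]_n).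

(** This relation is not transitive, as two unit steps in one coordinate add up to 2; comparability
    of the end points restores transitivity ([cle_trans]). *)
Definition cle x y : bool := [forall i, x 0 i <= y 0 i <= x 0 i + 1].
Definition cmp x y : bool := cle x y || cle y x.

Lemma cleP x y : reflect (forall i, x 0 i <= y 0 i <= x 0 i + 1) (cle x y).
Proof. exact: forallP. Qed.

Lemma cle_refl x : cle x x.
Proof. by apply/cleP => i; lia. Qed.

Lemma cmp_sym x y : cmp x y = cmp y x.
Proof. exact: orbC. Qed.

Lemma cle_anti x y : cle x y -> cle y x -> x = y.
Proof.
by move=> /cleP xy /cleP yx; apply/rowP => i; move: (xy i) (yx i); lia.
Qed.

Lemma cmp_cle x y : (forall i, x 0 i <= y 0 i) -> cmp x y -> cle x y.
Proof.
move=> xy /orP[//|/cleP yx]; apply/cleP => i; move: (xy i) (yx i); lia.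
Qed.

Lemma cle_trans x y z : cmp x z -> cle x y -> cle y z -> cle x z.
Proof.
move=> xz /cleP xy /cleP yz; apply: cmp_cle xz => i.
by move: (xy i) (yz i); lia.
Qed.

Lemma adjE x y : adj x y = (x != y) && cmp x y.
Proof.
have E u v : cube_vec (v - u) = (u != v) && cle u v.
  rewrite /cube_vec subr_eq0 eq_sym; congr (_ && _); apply: eq_forallb => i.
  rewrite !mxE; move: (v 0 i) (u 0 i) => a b.
  apply/orP/andP => [[/eqP ab|/eqP ab]|[ab1 ab2]]; [by split; lia|by split; lia|].
  have [ab|/eqP ab] := boolP (a - b == 0); [by left|right].
  by apply/eqP; lia.
by rewrite /adj !E (eq_sym y) -andb_orr.
Qed.

Definition height x : int := \sum_i x 0 i.

Lemma cle_height x y : cmp x y -> height x <= height y -> cle x y.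
Proof.
move=> /orP[//|yx] h; suff -> : x = y by exact: cle_refl.
have /cleP yx' := yx; apply/rowP => i; apply/eqP; move: h; apply: contraTT => xy.
rewrite -ltNge /height (bigD1 i) //= [ltRHS](bigD1 i) //=; apply: ltr_leD.
  by move: xy (yx' i); lia.
by apply: ler_sum => j _; move: (yx' j); lia.
Qed.

(** Sorting by [height] suffices, since for comparable points the order of the heights decides the
    direction of [cle]. *)
Lemma cmp_sorting p (v : 'I_p -> 'rV[int]_n) : (forall i j, cmp (v i) (v j)) ->
  exists s : 'S_p, forall i j : 'I_p, (i <= j)%N -> cle (v (s i)) (v (s j)).
Proof.
move=> vc; case: p v vc => [|p] v vc; first by exists 1%g => -[].
pose r i j := height (v i) <= height (v j).
pose q := sort r (enum 'I_p.+1).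
have sq : size q = p.+1 by rewrite size_sort size_enum_ord.
have uq : uniq q by rewrite sort_uniq enum_uniq.
pose g (i : 'I_p.+1) := nth ord0 q i.
have g_inj : injective g.
  by move=> i j /eqP; rewrite nth_uniq ?sq // => /eqP; apply: val_inj.
exists (perm g_inj) => i j ij; rewrite !permE; apply: cle_height => //.
have r_trans : transitive r by move=> ? ? ?; apply: le_trans.
have r_refl : reflexive r by move=> ?; apply: lexx.
have rs : sorted r q by apply: sort_sorted => ? ?; apply: le_total.
by apply: (sorted_leq_nth r_trans r_refl) => //; rewrite inE sq.
Qed.

Variables (m : nat) (c : 'I_m -> 'I_n).

(** In sorted order the steps between consecutive vertices are nonnegative, and each coordinate's
    steps telescope to the difference of the two ends of the chain, which is at most 1. *)
Lemma affine_vol_le1 (v : 'I_m.+1 -> 'rV[int]_n) : (forall i j, cmp (v i) (v j)) ->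
  `|affine_vol c v| <= 1.
Proof.
move=> vc; have [s sv] := cmp_sorting vc.
have -> : `|affine_vol c v| = `|affine_vol c (v \o s)|.
  by rewrite affine_vol_perm normrM normrX normrN1 expr1n mul1r.
rewrite affine_vol_steps; apply: det_le1 => [i j|j].
  rewrite mxE; have /cleP/(_ (c j)) := sv (widen_ord (leqnSn m) i) (lift ord0 i) (leqnSn i).
  by rewrite /=; lia.
pose f l := v (s (inord l)) 0 (c j).
rewrite (eq_bigr (fun i : 'I_m => f i.+1 - f i)) => [|i _]; last first.
  rewrite mxE /f /=; congr (v (s _) _ _ - v (s _) _ _); apply: val_inj;
    rewrite /= inordK // ltnS ?ltn_ord //.
  exact: ltnW (ltn_ord i).
rewrite -(big_mkord predT (fun i => f i.+1 - f i)) telescope_sumr //.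
have /orP[/cleP/(_ (c j))|/cleP/(_ (c j))] := vc (s (inord 0)) (s (inord m)); rewrite /f;
  lia.
Qed.

Definition iheight x : int := \sum_j x 0 (c j).

Lemma iheight_le x y : cle x y -> 0 <= iheight y - iheight x <= m%:Z.
Proof.
rewrite /iheight -sumrB => /cleP xy; apply/andP; split.
  by apply: sumr_ge0 => j _; move: (xy (c j)); lia.
apply: le_trans (_ : \sum_(j < m) 1 <= _); last by rewrite sumr_const card_ord natz.
by apply: ler_sum => j _; move: (xy (c j)); lia.
Qed.

Lemma iheight_cmp x y : cmp x y -> `|iheight x - iheight y| <= m%:Z.
Proof. by move=> /orP[]/iheight_le; lia. Qed.

(** The coordinate differences of comparable points all have one sign, so a zero sum makes each of
    them zero. *)
Lemma iheight_inj x y : cmp x y -> iheight x = iheight y -> forall j, x 0 (c j) = y 0 (c j).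
Proof.
wlog xy : x y / cle x y => [W|_ /esym/eqP].
  by case/orP=> [xy E j|yx E j]; [apply: W|apply/esym/W] => //; rewrite /cmp ?xy ?yx ?orbT.
have /cleP xy' := xy; rewrite /iheight -subr_eq0 -sumrB psumr_eq0 => [/allP E j|j _].
  by have := E j (mem_index_enum j); rewrite subr_eq0 => /eqP.
by move: (xy' (c j)); lia.
Qed.

(* The [m + 1] vertices of a nondegenerate clique have pairwise distinct heights
   differing by at most [m], hence all residues modulo [m + 1]; a further
   comparable point shares its height with one of them. *)
Lemma affine_vol_maximal (v : 'I_m.+1 -> 'rV[int]_n) y :
  (forall i j, cmp (v i) (v j)) -> affine_vol c v != 0 -> (forall i, cmp (v i) y) ->
  exists i, forall j, y 0 (c j) = v i 0 (c j).
Proof.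
move=> vc v0 vy.
pose r x : 'I_m.+1 := inord `|(iheight x %% m.+1)%Z|%N.
have rP x x' : cmp x x' -> r x = r x' -> iheight x = iheight x'.
  move=> /iheight_cmp xx' /(congr1 val); rewrite /r /= !inordK; last 2 first.
  - by have := ltz_pmod (iheight x') (isT : (0 < m.+1 :> int));
    have := modz_ge0 (iheight x') (isT : m.+1%:Z != 0); lia.
  - by have := ltz_pmod (iheight x) (isT : (0 < m.+1 :> int));
    have := modz_ge0 (iheight x) (isT : m.+1%:Z != 0); lia.
  have := modz_ge0 (iheight x) (isT : m.+1%:Z != 0).
  have := modz_ge0 (iheight x') (isT : m.+1%:Z != 0).
  have := divz_eq (iheight x) m.+1; have := divz_eq (iheight x') m.+1.
  move: (iheight x %% _)%Z (iheight x %/ _)%Z (iheight x' %% _)%Z (iheight x' %/ _)%Z xx'.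
  move: (iheight x) (iheight x') => h h' a q a' q' hh' E' E a0' a0 aa'.
  have {}aa' : a = a' by lia.
  have [qq|qq'] := eqVneq q q'; first by rewrite E E' qq aa'.
  (* With equal residues, [h - h'] is a nonzero multiple of [m + 1] when the quotients differ, while
     [hh'] bounds it by [m]. *)
  exfalso; nia.
have inj : injective (r \o v).
  move=> i j /rP E; apply/eqP/negPn/negP => ij; move: v0.
  by rewrite (affine_vol_eq0 ij (iheight_inj (vc i j) (E (vc i j)))) eqxx.
have /codomP[i /= Ei] : r y \in codom (r \o v) by apply: inj_card_onto; rewrite ?card_ord.
exists i => j; apply/esym/iheight_inj => //; apply: rP => //.
Qed.

End CubeOrder.

Definition fcons (T : Type) (m : nat) (x : T) (t : 'I_m -> T) (i : 'I_m.+1) : T :=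
  if unlift ord0 i is Some j then t j else x.

Lemma fcons0 (T : Type) m (x : T) (t : 'I_m -> T) : fcons x t ord0 = x.
Proof. by rewrite /fcons unlift_none. Qed.

Lemma fconsS (T : Type) m (x : T) (t : 'I_m -> T) j : fcons x t (lift ord0 j) = t j.
Proof. by rewrite /fcons liftK. Qed.

(** * Vertices completing a clique *)

Section Neighbours.
Variables (n m : nat) (c : 'I_m -> 'I_n).
Implicit Types (x y z : 'rV[int]_n).

Lemma eq_affine_vol (v w : 'I_m.+1 -> 'rV[int]_n) :
  (forall i j, v i 0 (c j) = w i 0 (c j)) -> affine_vol c v = affine_vol c w.
Proof.
move=> E; congr (\det _); apply/matrixP => i j; rewrite !mxE.
by case: unliftP.
Qed.

(** The cofactors along the first row do not involve the first vertex, so the volume is affine in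
    it; the entry 1 balances because both sides have two terms. *)
Lemma affine_vol_fcons (t : 'I_m -> 'rV[int]_n) (a b x y : 'rV[int]_n) :
  (forall i, a 0 i + b 0 i = x 0 i + y 0 i) ->
  affine_vol c (fcons a t) + affine_vol c (fcons b t) =
  affine_vol c (fcons x t) + affine_vol c (fcons y t).
Proof.
move=> E.
have cofE z j : cofactor (affine_mx c (fcons z t)) ord0 j =
    cofactor (affine_mx c (fcons 0 t)) ord0 j.
  congr (_ * \det _); apply/matrixP => i l; rewrite !mxE.
  by case: unliftP => // l' _; rewrite !fconsS.
have dE z : affine_vol c (fcons z t) = \sum_j
    (if unlift ord0 j is Some j' then z 0 (c j') else 1) *
    cofactor (affine_mx c (fcons 0 t)) ord0 j.
  rewrite /affine_vol (expand_det_row _ ord0); apply: eq_bigr => j _.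
  by rewrite cofE mxE fcons0.
rewrite !dE -!big_split; apply: eq_bigr => j _ /=; rewrite -!mulrDl.
by case: unliftP => // j' _; rewrite E.
Qed.

Variables (t : 'I_m -> 'rV[int]_n) (tc : forall i j, cmp (t i) (t j)).

Local Notation vol1 z := (affine_vol c (fcons z t)).
Local Notation nb z := (forall j, cmp z (t j)).

Lemma fcons_cmp z : nb z -> forall i j, cmp (fcons z t i) (fcons z t j).
Proof.
move=> zt i j; case: (unliftP ord0 i) => [i'|] ->; case: (unliftP ord0 j) => [j'|] ->;
  rewrite ?fcons0 ?fconsS //; first by rewrite cmp_sym.
by rewrite /cmp cle_refl.
Qed.

Lemma vol1_vertex z j : (forall l, z 0 (c l) = t j 0 (c l)) -> vol1 z = 0.
Proof.
move=> E; apply: (affine_vol_eq0 (neq_lift ord0 j)) => l.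
by rewrite fcons0 fconsS.
Qed.

Lemma vol1_le1 z : nb z -> -1 <= vol1 z <= 1.
Proof. by move=> /fcons_cmp/(affine_vol_le1 c); lia. Qed.

Lemma vol1_maximal z y : nb z -> nb y -> cmp z y -> vol1 z != 0 ->
  (forall l, y 0 (c l) = z 0 (c l)) \/ exists j, forall l, y 0 (c l) = t j 0 (c l).
Proof.
move=> zt yt zy z0; have [|i] := affine_vol_maximal (fcons_cmp zt) z0 (y := y).
  by move=> i; case: (unliftP ord0 i) => [j|] ->; rewrite ?fconsS ?fcons0 // cmp_sym.
case: (unliftP ord0 i) => [j|] -> E; [right; exists j|left] => l.
  by rewrite E fconsS.
by rewrite E fcons0.
Qed.

(** The shadow of a point is its projection to the coordinates [c]. Sharing it with a vertex of [t]
    would make the volume of [y] zero. *)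
Lemma vol1_shadow z y : nb z -> nb y -> cmp z y -> vol1 z != 0 -> vol1 y != 0 ->
  forall l, y 0 (c l) = z 0 (c l).
Proof.
move=> zt yt zy z0 y0; have [//|[j E]] := vol1_maximal zt yt zy z0.
by rewrite (vol1_vertex E) eqxx in y0.
Qed.

(** The volume of [y] is left open here: if [y] had the shadow of some [t j], then [z], squeezed
    between the two, would have it too and be degenerate. *)
Lemma vol1_shadow_above z y : nb z -> nb y -> (forall j, cle (t j) z) -> cle z y ->
  vol1 z != 0 -> forall l, y 0 (c l) = z 0 (c l).
Proof.
move=> zt yt tz zy z0; have [|//|[j E]] := vol1_maximal zt yt _ z0;
  first by rewrite /cmp zy.
have E' l : z 0 (c l) = t j 0 (c l).
  by move/cleP/(_ (c l)): (tz j); move/cleP/(_ (c l)): zy; rewrite E; lia.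
by rewrite (vol1_vertex E') eqxx in z0.
Qed.

Lemma chain_extrema (A : {set 'I_m}) i0 : i0 \in A ->
  exists a b, [/\ a \in A, b \in A, forall j, j \in A -> cle (t j) (t a) &
    forall j, j \in A -> cle (t b) (t j)].
Proof.
move=> Ai0.
case: (@Order.TotalTheory.arg_maxP _ _ _ i0 (mem A) (fun i => height (t i)) Ai0) => a Aa aP.
case: (@Order.TotalTheory.arg_minP _ _ _ i0 (mem A) (fun i => height (t i)) Ai0) => b Ab bP.
by exists a, b; split=> // j Aj; apply: cle_height => //; [apply: aP|apply: bP].
Qed.

(** If a chain vertex separated [z'] from [z], the whole chain would lie above [z'] and below [z].
    Reflecting [z'] through the ends of the chain gives a point [y] above the chain with the
    opposite volume; the join of [y] and [z] forces equal shadows, hence equal volumes. *)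
Lemma neighbours_separated z z' : nb z -> nb z' -> vol1 z = vol1 z' -> vol1 z != 0 ->
  ~ exists j, cle z' (t j) && cle (t j) z.
Proof.
move=> zt zt' zz' z0 [j /andP[z'j jz]]; have z'0 : vol1 z' != 0 by rewrite -zz'.
(* If [z'] were below [z], both would have one shadow, and [t j] between them would share it. *)
have bad : ~ cle z' z.
  move=> z'z; have E := vol1_shadow zt zt' (_ : cmp z z') z0 z'0.
  have {}E l : z' 0 (c l) = z 0 (c l) by apply: E; rewrite /cmp z'z orbT.
  suff E' l : z 0 (c l) = t j 0 (c l) by rewrite (vol1_vertex E') eqxx in z0.
  by move/cleP/(_ (c l)): z'j; move/cleP/(_ (c l)): jz; rewrite E; lia.
(* A chain vertex below [z'] would also be below [z] and limit the distance from [z'] to [z] to one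
   unit per coordinate, contrary to [bad]. *)
have below w : cle z' (t w).
  case/orP: (zt' w) => // wz'; case: bad.
  have wz : cle (t w) z.
    apply: cmp_cle => [i|]; last by rewrite cmp_sym.
    by move/cleP/(_ i): z'j; move/cleP/(_ i): jz; move/cleP/(_ i): wz'; lia.
  apply/cleP => i; move/cleP/(_ i): z'j; move/cleP/(_ i): jz.
  by move/cleP/(_ i): wz'; move/cleP/(_ i): wz; lia.
have above w : cle (t w) z.
  case/orP: (zt w) => // zw; case: bad.
  apply/cleP => i; move/cleP/(_ i): z'j; move/cleP/(_ i): jz.
  by move/cleP/(_ i): zw; move/cleP/(_ i): (below w); lia.
have [a [b [_ _ amax bmin]]] := chain_extrema (finset.in_setT j).
pose y : 'rV[int]_n := \row_i (t a 0 i + t b 0 i - z' 0 i).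
have yE i : y 0 i = t a 0 i + t b 0 i - z' 0 i by rewrite mxE.
have ty w : cle (t w) y.
  apply/cleP => i; rewrite yE; move/cleP/(_ i): (amax w (finset.in_setT w));
    move/cleP/(_ i): (bmin w (finset.in_setT w)).
  by move/cleP/(_ i): (below a); move/cleP/(_ i): (below b); move/cleP/(_ i): (below w);
    lia.
have yv : vol1 y = - vol1 z'.
  have ab i : y 0 i + z' 0 i = t a 0 i + t b 0 i by rewrite yE; lia.
  have := affine_vol_fcons t ab.
  by rewrite (@vol1_vertex (t a) a) // (@vol1_vertex (t b) b) //; lia.
(* [z] and [y] need not be comparable; their join is above both and still a neighbour of the
   chain. *)
pose u : 'rV[int]_n := \row_i Num.max (z 0 i) (y 0 i).
have uE i : u 0 i = Num.max (z 0 i) (y 0 i) by rewrite mxE.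
have tu w : cle (t w) u.
  apply/cleP => i; rewrite uE.
  by move/cleP/(_ i): (above w); move/cleP/(_ i): (ty w); lia.
have zu : cle z u.
  apply/cleP => i; rewrite uE.
  by move/cleP/(_ i): (above j); move/cleP/(_ i): (ty j); lia.
have yu : cle y u.
  apply/cleP => i; rewrite uE.
  by move/cleP/(_ i): (above j); move/cleP/(_ i): (ty j); lia.
have nu : nb u by move=> w; rewrite cmp_sym /cmp tu.
have ny : nb y by move=> w; rewrite cmp_sym /cmp ty.
have y0 : vol1 y != 0 by rewrite yv oppr_eq0.
have E l : z 0 (c l) = y 0 (c l).
  by rewrite -(vol1_shadow_above zt nu above zu z0) (vol1_shadow_above ny nu ty yu y0).
have : vol1 z = vol1 y.
  apply: eq_affine_vol => i l; case: (unliftP ord0 i) => [i'|] ->;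
    rewrite ?fconsS ?fcons0 //.
by move: z0; rewrite yv -zz'; lia.
Qed.

(* Two neighbours of equal nonzero volume lie in the same gap of the chain [t];
   then their meet also has that volume and has the same shadow as both. *)
Lemma neighbour_inj (i0 : 'I_m) z z' : nb z -> nb z' -> vol1 z = vol1 z' -> vol1 z != 0 ->
  (forall i, i \notin codom c -> odd (absz (z 0 i)) = odd (absz (z' 0 i))) -> z = z'.
Proof.
move=> zt zt' zz' z0 par; have z'0 : vol1 z' != 0 by rewrite -zz'.
have N1 := neighbours_separated zt zt' zz' z0.
have N2 := neighbours_separated zt' zt (esym zz') z'0.
have slot j : (cle (t j) z /\ cle (t j) z') \/ (cle z (t j) /\ cle z' (t j)).
  case/orP: (zt j) => h; case/orP: (zt' j) => h'; try by [left|right].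
  - by case: N2; exists j; rewrite h.
  - by case: N1; exists j; rewrite h h'.
(* Both points lie within one unit of [t i0], on the same side of it. This is what lets parities
   decide outside the codomain of [c]. *)
have close i : -1 <= z 0 i - z' 0 i <= 1.
  by case: (slot i0) => -[/cleP/(_ i) h /cleP/(_ i) h']; lia.
pose u : 'rV[int]_n := \row_i Num.min (z 0 i) (z' 0 i).
have uE i : u 0 i = Num.min (z 0 i) (z' 0 i) by rewrite mxE.
pose w : 'rV[int]_n := \row_i Num.max (z 0 i) (z' 0 i).
have wE i : w 0 i = Num.max (z 0 i) (z' 0 i) by rewrite mxE.
have nu : nb u.
  move=> j; case: (slot j) => -[/cleP h /cleP h']; apply/orP; [right|left];
    by apply/cleP => i; rewrite uE; move: (h i) (h' i); lia.
have nw : nb w.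
  move=> j; case: (slot j) => -[/cleP h /cleP h']; apply/orP; [right|left];
    by apply/cleP => i; rewrite wE; move: (h i) (h' i); lia.
have uw : vol1 u + vol1 w = vol1 z + vol1 z'.
  by apply: affine_vol_fcons => i; rewrite uE wE; lia.
(* Meet and join volumes sum to 2 or -2, while each is at most 1 in absolute value, so neither is
   zero. *)
have u0 : vol1 u != 0.
  by move: (vol1_le1 nu) (vol1_le1 nw) (vol1_le1 zt) z0 uw zz'; lia.
have uz : cmp z u by apply/orP; right; apply/cleP => i; rewrite uE; move: (close i); lia.
have uz' : cmp z' u by apply/orP; right; apply/cleP => i; rewrite uE; move: (close i); lia.
apply/rowP => i; have [/codomP[l ->]|/par] := boolP (i \in codom c).
  by rewrite -(vol1_shadow zt nu uz z0 u0) (vol1_shadow zt' nu uz' z'0 u0).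
by move: (close i); lia.
Qed.

(* [x |-> t a + t b - x], where [t a] and [t b] are the chain vertices just below
   and just above [x], or the two ends of the chain when [x] lies outside it. *)
Lemma reflection (i0 : 'I_m) : exists a b : 'rV[int]_n -> 'I_m,
  let sigma x := t (a x) + t (b x) - x in
  forall x, (forall j, adj x (t j)) ->
    (forall j, adj (sigma x) (t j)) /\ sigma (sigma x) = x.
Proof.
have /choice[mx mxP] (A : {set 'I_m}) : exists a, A != finset.set0 ->
    a \in A /\ forall j, j \in A -> cle (t j) (t a).
  have [->|/set0Pn[i /chain_extrema[a [b [? ? ? ?]]]]] := eqVneq A finset.set0;
    last by exists a.
  by exists i0.
have /choice[mn mnP] (A : {set 'I_m}) : exists b, A != finset.set0 ->
    b \in A /\ forall j, j \in A -> cle (t b) (t j).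
  have [->|/set0Pn[i /chain_extrema[a [b [? ? ? ?]]]]] := eqVneq A finset.set0;
    last by exists b.
  by exists i0.
pose L x := [set j | cle (t j) x].
pose out x := (L x == finset.set0) || (L x == finset.setT).
pose a x := if out x then mx finset.setT else mx (L x).
pose b x := if out x then mn finset.setT else mn (~: L x).
exists a, b => sigma.
have T0 : finset.setT != finset.set0 :> {set 'I_m} by apply/set0Pn; exists i0.
have sE x i : sigma x 0 i = t (a x) 0 i + t (b x) 0 i - x 0 i by rewrite !mxE.
have adj_of x : (forall j, cmp x (t j)) -> (forall j, x != t j) -> forall j, adj x (t j).
  by move=> xc xn j; rewrite adjE xc xn.
(* Inside the chain the gap is kept; outside, the two ends are exchanged. Either way [out] is
   preserved and the same [a], [b] serve for [sigma x], so [sigma] is an involution. *)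
suff H x : (forall j, adj x (t j)) -> [/\ forall j, cmp (sigma x) (t j),
    forall j, sigma x != t j & L (sigma x) = if out x then ~: L x else L x].
  move=> x xt; have [sc sn sL] := H x xt; split; first exact: adj_of.
  have outs : out (sigma x) = out x.
    by rewrite /out sL; case: ifP => // /orP[]/eqP->;
      rewrite ?finset.setC0 ?finset.setCT !eqxx ?orbT.
  have E : sigma (sigma x) = t (a x) + t (b x) - sigma x.
    rewrite {1}/sigma {1}/a {1}/b outs; rewrite /a /b sL; by case: (out x).
  by rewrite E opprB addrC subrK.
move=> xt; have xc j : cmp x (t j) by have := xt j; rewrite adjE => /andP[].
have xn j : x != t j by have := xt j; rewrite adjE => /andP[].
have Lx j : j \notin L x -> cle x (t j) by rewrite inE => jx; case/orP: (xc j) => // ;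
  rewrite (negbTE jx).
have xnot j : cle x (t j) -> j \notin L x.
  by move=> xj; rewrite inE; apply/negP => jx; case/negP: (xn j); apply/eqP/cle_anti.
set B := if out x then _ else _.
suff [sl su sn] : [/\ forall j, j \in B -> cle (t j) (sigma x),
    forall j, j \notin B -> cle (sigma x) (t j) & forall j, sigma x != t j].
  have sc j : cmp (sigma x) (t j).
    by rewrite /cmp; case: (boolP (j \in B)) => [/sl|/su] ->; rewrite ?orbT.
  split=> //; apply/finset.setP => j; rewrite inE; apply/idP/idP => [jx|/sl//].
  apply/negPn/negP => /su xj; case/negP: (sn j); apply/eqP; exact: cle_anti.
have [ox|nox] := boolP (out x); last first.
  have [Ln0 LnT] : L x != finset.set0 /\ ~: L x != finset.set0.
    move: nox; rewrite negb_or => /andP[-> nT]; split=> //; apply: contra nT.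
    by rewrite -(inj_eq (@finset.setC_inj _) (L x)) finset.setCT.
  have BE : B = L x by rewrite /B (negbTE nox).
  have aE : a x = mx (L x) by rewrite /a (negbTE nox).
  have bE : b x = mn (~: L x) by rewrite /b (negbTE nox).
  have [aL amax] := mxP _ Ln0; have [bL bmin] := mnP _ LnT.
  rewrite -aE in aL amax; rewrite -bE in bL bmin.
  have ax : cle (t (a x)) x by rewrite inE in aL.
  have xb : cle x (t (b x)) by apply: Lx; rewrite inE in bL.
  rewrite BE; split=> [j jL|j jL|j].
  - have jx : cle (t j) x by rewrite inE in jL.
    have jb : cle (t j) (t (b x)) by apply: cle_trans jx xb.
    apply/cleP => i; rewrite sE; move/cleP/(_ i): (amax j jL); move/cleP/(_ i): jb.
    by move/cleP/(_ i): ax; move/cleP/(_ i): xb; lia.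
  - have xj := Lx j jL; have aj : cle (t (a x)) (t j) by apply: cle_trans ax xj.
    have jL' : j \in ~: L x by rewrite inE.
    apply/cleP => i; rewrite sE; move/cleP/(_ i): (bmin j jL'); move/cleP/(_ i): aj.
    by move/cleP/(_ i): ax; move/cleP/(_ i): xb; lia.
  - apply/eqP => E; have Ei i : sigma x 0 i = t j 0 i by rewrite E.
    have [jL|jL] := boolP (j \in L x).
      case/negP: (xn (b x)); apply/eqP/cle_anti => //; apply: cmp_cle => [i|];
        last by rewrite cmp_sym.
      by have := Ei i; rewrite sE; move/cleP/(_ i): (amax j jL); lia.
    have jL' : j \in ~: L x by rewrite inE.
    case/negP: (xn (a x)); apply/eqP/cle_anti => //; apply: cmp_cle => [i|]; last exact: xc.
    by have := Ei i; rewrite sE; move/cleP/(_ i): (bmin j jL'); lia.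
have BE : B = ~: L x by rewrite /B ox.
have [_ amax] := mxP _ T0; have [_ bmin] := mnP _ T0.
have aE : a x = mx finset.setT by rewrite /a ox.
have bE : b x = mn finset.setT by rewrite /b ox.
rewrite -aE in amax; rewrite -bE in bmin.
have ba i j : t (b x) 0 i <= t j 0 i <= t (a x) 0 i.
  move/cleP/(_ i): (amax j (finset.in_setT j));
    move/cleP/(_ i): (bmin j (finset.in_setT j)); lia.
rewrite BE; case/orP: ox => /eqP LE.
  have xj j : cle x (t j) by apply: Lx; rewrite LE inE.
  split=> [j _|j|j].
  - apply/cleP => i; rewrite sE; move: (ba i j).
    by move/cleP/(_ i): (xj (a x)); move/cleP/(_ i): (xj (b x)); lia.
  - by rewrite LE !inE.
  - apply/eqP => E; have Ei i : sigma x 0 i = t j 0 i by rewrite E.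
    case/negP: (xn (b x)); apply/eqP/cle_anti => //; apply: cmp_cle => [i|];
      last by rewrite cmp_sym.
    by have := Ei i; rewrite sE; move: (ba i j); lia.
have xj j : cle (t j) x by have := finset.in_setT j; rewrite -LE inE.
split=> [j|j _|j].
- by rewrite LE !inE.
- apply/cleP => i; rewrite sE; move: (ba i j).
  by move/cleP/(_ i): (xj (a x)); move/cleP/(_ i): (xj (b x)); lia.
- apply/eqP => E; have Ei i : sigma x 0 i = t j 0 i by rewrite E.
  case/negP: (xn (a x)); apply/eqP/cle_anti => //; apply: cmp_cle => [i|]; last exact: xc.
  by have := Ei i; rewrite sE; move: (ba i j); lia.
Qed.

End Neighbours.

(** * Volume forms on the closure of Ω *)

Lemma card_tuples_spanning (T : finType) m (S : {set T}) : #|S| = m ->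
  #|[set t : m.-tuple T | [set x in t] == S]| = m`!.
Proof.
move=> Sm; transitivity (#|S| ^_ m); last by rewrite Sm ffactnn.
rewrite -card_uniq_tuples; apply: eq_card => t; rewrite !inE.
apply/eqP/andP => [tS|[/allP tS ut]].
  split.
    apply/allP => x xt; have : x \in [set y in t] by rewrite inE.
    by rewrite tS.
  apply/card_uniqP; rewrite size_tuple -[RHS]Sm -tS; apply: eq_card => x; by rewrite inE.
apply/eqP; rewrite eqEcard; apply/andP; split.
  by apply/fintype.subsetP => x; rewrite inE => /tS.
by rewrite cardsE (card_uniqP ut) size_tuple Sm.
Qed.

Lemma vol_perm n m (c : 'I_m -> 'I_n) v (s : 'S_m) :
  vol c (v \o s) = (-1) ^+ s * vol c v.
Proof.
rewrite /vol -det_perm -det_mulmx -row_permE.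
by congr (\det _); apply/matrixP => i j; rewrite !mxE.
Qed.

Lemma vol_fcons n m (c : 'I_m.+1 -> 'I_n) (t : 'I_m -> 'rV[int]_n)
    (a b x y : 'rV[int]_n) :
  (forall i, x 0 i = a 0 i + b 0 i - y 0 i) ->
  vol c (fcons x t) = vol c (fcons a t) + vol c (fcons b t) - vol c (fcons y t).
Proof.
move=> E.
have dE z : vol c (fcons z t) = \sum_j z 0 (c j) *
    cofactor (\matrix_(i, j) fcons (0 : 'rV[int]_n) t i 0 (c j)) ord0 j.
  rewrite /vol (expand_det_row _ ord0); apply: eq_bigr => j _.
  rewrite mxE fcons0; congr (_ * (_ * \det _)); apply/matrixP => i l; rewrite !mxE.
  by rewrite !fconsS.
rewrite !dE -big_split -sumrB /=; apply: eq_bigr => j _.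
by rewrite E mulrBl mulrDl.
Qed.

Lemma vol_eq0 n m (c : 'I_m -> 'I_n) (v : 'I_m -> 'rV[int]_n) i j :
  i != j -> v i = v j -> vol c v = 0.
Proof. by move=> ij E; apply: (determinant_alternate ij) => l; rewrite !mxE E. Qed.

Section Tessellation.
Variables (R : realType) (n : nat) (Om : {fset 'rV[int]_n}).
Local Notation H := (tilde Om).

Definition pos (u : H) : 'rV[int]_n := val u.
Definition tpos m (t : m.-tuple H) (i : 'I_m) : 'rV[int]_n := pos (tnth t i).

Lemma tilde_interior (u : H) : (u \notin bdry H) = (pos u \in Om).
Proof.
rewrite inE; have := valP u; rewrite /= inE.
case: (boolP (val u \in Om)) => /= uO; last by move=> ->.
by move=> _; apply/negP => /vboundaryP[/negP].
Qed.

Lemma tilde_edgeE (u v : H) :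
  edge u v = adj (pos u) (pos v) && ((pos u \in Om) || (pos v \in Om)).
Proof. by []. Qed.

Lemma tilde_bdry_indep (u v : H) : u \in bdry H -> v \in bdry H -> ~~ edge u v.
Proof.
move=> uB vB; rewrite tilde_edgeE negb_and negb_or -!tilde_interior !negbK uB vB.
exact: orbT.
Qed.

Lemma tpos_cons m (u : H) (t : m.-tuple H) : tpos [tuple of u :: t] =1 fcons (pos u)
  (tpos t).
Proof.
move=> i; rewrite /tpos; case: (unliftP ord0 i) => [j|] ->; last by rewrite tnth0 fcons0.
by rewrite tnthS fconsS.
Qed.

Lemma spans_cmp m (t : m.-tuple H) i j : spans_clique t -> cmp (tpos t i) (tpos t j).
Proof.
move=> /spans_cliqueP e; have [->|ij] := eqVneq i j; first by rewrite /cmp cle_refl.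
by have := e _ _ ij; rewrite tilde_edgeE adjE => /andP[/andP[]].
Qed.

Lemma spans_cons_cmp m u (t : m.-tuple H) j : spans_clique [tuple of u :: t] ->
  cmp (pos u) (tpos t j).
Proof.
by move=> /(spans_cmp ord0 (lift ord0 j)); rewrite !tpos_cons fcons0 fconsS.
Qed.

Lemma spans_cons_interior m u (t : m.-tuple H) :
  spans_clique t -> (forall j, tpos t j \in Om) ->
  spans_clique [tuple of u :: t] = [forall j, adj (pos u) (tpos t j)].
Proof.
move=> st tO; rewrite spans_cons st andTb; apply: eq_forallb => j.
by rewrite tilde_edgeE tO orbT andbT.
Qed.

(** The involution of [reflection] permutes the completions and changes the sign of [F], so the sum
    equals its own negative; fixed points do no harm. *)
Lemma sum_reflect m (t : m.+1.-tuple H) (F : 'rV[int]_n -> int) :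
  spans_clique t -> (forall j, tpos t j \in Om) ->
  (forall a b x, F (tpos t a + tpos t b - x) = - F x) ->
  \sum_(u : H | spans_clique [tuple of u :: t]) F (pos u) = 0.
Proof.
move=> st tO Fr.
have [a [b]] := reflection (fun i j => spans_cmp i j st) ord0.
set sigma := fun x => _; rewrite -/sigma => sP.
pose P (u : H) := [forall j, adj (pos u) (tpos t j)].
pose sH (u : H) : H := insubd u (sigma (pos u)).
have sHE u : P u -> pos (sH u) = sigma (pos u).
  move=> /forallP Pu; have [Ps _] := sP _ Pu; rewrite /pos val_insubd.
  rewrite ifT // inE; case: (boolP (_ \in Om)) => //= nO.
  by apply/vboundaryP; split=> //; exists (tpos t ord0) => //; rewrite adj_sym.
have sHP u : P u -> P (sH u).
  by move=> Pu; apply/forallP => j; rewrite sHE //; apply: (sP _ (forallP Pu)).1.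
have sHK u : P u -> sH (sH u) = u.
  move=> Pu; apply: val_inj; rewrite -!/(pos _) sHE ?sHP // sHE //.
  exact: (sP _ (forallP Pu)).2.
set S := \sum_(u | _) _; suff : S = - S by lia.
have SE : S = \sum_(u | P u) F (pos u).
  by apply: eq_bigl => u; rewrite spans_cons_interior.
rewrite {1}SE (reindex_onto sH sH) /=; last by move=> u; apply: sHK.
rewrite SE -sumrN; apply: eq_big => [u|u /andP[Psu /eqP us]].
  apply/andP/idP => [[Psu /eqP us]|Pu]; first by have := sHP _ Psu; rewrite us.
  by split; [apply: sHP|apply/eqP/sHK].
by rewrite sHE ?Fr //; have := sHP _ Psu; rewrite us.
Qed.

Section Coordinates.
Variables (k : nat) (c : 'I_k.+1 -> 'I_n).

Definition vol_form : cochain R H k :=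
  [ffun t : k.+1.-tuple H => if spans_clique t then (vol c (tpos t))%:~R else 0].

Lemma vol_form_forms : vol_form \in forms R H k.
Proof.
apply/mem_forms; split=> [s t|t nt]; rewrite !ffunE; last by rewrite (negbTE nt).
rewrite spans_clique_perm; case: ifP => _; last by rewrite mulr0.
have -> : tpos (perm_tuple s t) = tpos t \o s.
  by apply/funext => i; rewrite /tpos tnth_mktuple.
by rewrite vol_perm intrM rmorph_sign.
Qed.

Lemma d_vol_formE t : spans_clique t -> d vol_form t = (affine_vol c (tpos t))%:~R.
Proof.
move=> st; rewrite ffunE st affine_volE rmorph_sum; apply: eq_bigr => j _ /=.
rewrite ffunE -/(face j t) spans_face // rmorphM rmorph_sign /=; congr (_ * (vol c _)%:~R).
by apply/funext => i; rewrite /tpos tnth_mktuple.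
Qed.

Let vf := vol_form_forms.

Lemma cod_d_vol_formE t : cod (d vol_form) t =
  (\sum_(u | spans_clique [tuple of u :: t]) affine_vol c (fcons (pos u) (tpos t)))%:~R.
Proof.
rewrite ffunE rmorph_sum [RHS]big_mkcond /=; apply: eq_bigr => u _.
case: ifP => [sp|/negbT/form_off ->//]; last by rewrite d_forms.
by rewrite d_vol_formE //; congr _%:~R; apply: eq_affine_vol => i j; rewrite tpos_cons.
Qed.

(** Affinity in the completing vertex, together with vanishing at the vertices of [t], gives the
    sign change required by [sum_reflect]. *)
Lemma cod_d_vol_form_interior : vanishes_in_interior (cod (d vol_form)).
Proof.
move=> t st tO; rewrite cod_d_vol_formE.
rewrite (sum_reflect (F := fun x => affine_vol c (fcons x (tpos t)))) // => [j|a b x].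
  by rewrite -tilde_interior; have := tO _ (mem_tnth j t); rewrite inE.
have E i : (tpos t a + tpos t b - x) 0 i + x 0 i = tpos t a 0 i + tpos t b 0 i.
  by rewrite !mxE subrK.
have := affine_vol_fcons c (tpos t) E.
by rewrite (@vol1_vertex _ _ _ _ (tpos t a) a) // (@vol1_vertex _ _ _ _ (tpos t b) b) //;
  lia.
Qed.

End Coordinates.

(** The same cancellation with linearity of [vol]. The form has positive degree, so [t] is nonempty
    and there are vertices to reflect through. *)
Lemma cod_vol_form_interior k (c : 'I_k.+2 -> 'I_n) : vanishes_in_interior (cod (vol_form
  c)).
Proof.
move=> t st tO; have -> : cod (vol_form c) t =
    (\sum_(u | spans_clique [tuple of u :: t]) vol c (fcons (pos u) (tpos t)))%:~R.
  rewrite ffunE rmorph_sum [RHS]big_mkcond /=; apply: eq_bigr => u _.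
  rewrite ffunE; case: ifP => // _; congr (vol c _)%:~R.
  by apply/funext => i; rewrite tpos_cons.
rewrite (sum_reflect (F := fun x => vol c (fcons x (tpos t)))) // => [j|a b x].
  by rewrite -tilde_interior; have := tO _ (mem_tnth j t); rewrite inE.
have E i : (tpos t a + tpos t b - x) 0 i = tpos t a 0 i + tpos t b 0 i - x 0 i.
  by rewrite !mxE.
have v0 j : vol c (fcons (tpos t j) (tpos t)) = 0.
  by apply: (vol_eq0 c (neq_lift ord0 j)); rewrite fcons0 fconsS.
by rewrite (vol_fcons c (tpos t) E) !v0; lia.
Qed.

(* All tuple positions carry the same share of interior vertices, so counting
   over all positions gives [(k + 2) X = (k + 1) (k + 2)! |C_{k+2}(∂Ω)|]. *)
Lemma card_bcliques_head k :
  #|[set t : k.+2.-tuple H | ([set x in t] \in bcliques H k.+2) && (thead t \notin bdry H)]|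
  = (k.+1 * k.+1`! * #|bcliques H k.+2|)%N.
Proof.
set X := #|_|; set BC := bcliques H k.+2.
have XE j : X = (\sum_(t : k.+2.-tuple H | [set x in t] \in BC) (tnth t j \notin bdry H))%N.
  rewrite /X -sum1_card -big_mkcondr /=.
  rewrite [LHS]big_mkcond [RHS]big_mkcond.
  rewrite [LHS](reindex_inj (@perm_tuple_inj H _ (lift_perm ord0 j 1)));
    apply: eq_bigr => t _ /=.
  have E : [set x in perm_tuple (lift_perm ord0 j 1) t] = [set x in t].
    by apply/finset.setP => x; rewrite !inE mem_perm_tuple.
  by rewrite inE /thead E tnth_mktuple lift_perm_id.
have key : (k.+2 * X = k.+1 * (k.+2`! * #|BC|))%N.
  rewrite -[in LHS](card_ord k.+2) -sum_nat_const.
  under eq_bigr => j _ do rewrite (XE j).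
  rewrite exchange_big /=.
  transitivity (\sum_(t : k.+2.-tuple H | [set x in t] \in BC) k.+1)%N.
    apply: eq_bigr => t; rewrite inE => /andP[st /eqP c1].
    have : [set x in t] :&: bdry H != finset.set0 by rewrite -card_gt0 c1.
    case/set0Pn=> x /finset.setIP[]; rewrite inE => /tnthP[j ->] jB.
    transitivity (\sum_(i < k.+2 | i != j) 1)%N; last by rewrite sum1_card cardC1 card_ord.
    rewrite (bigD1 j) // jB.
    change (\sum_(i < k.+2 | i != j) nat_of_bool (tnth t i \notin bdry H) =
      \sum_(i < k.+2 | i != j) 1)%N.
    apply: eq_bigr => i ij; suff -> : tnth t i \notin bdry H by [].
    by apply: contraL (spans_cliqueP _ st i j ij) => iB; apply: tilde_bdry_indep.
  rewrite sum_nat_const mulnC; congr (_ * _)%N.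
  rewrite -sum1_card (partition_big (fun t : k.+2.-tuple H => [set x in t]) (mem BC)) //=.
  rewrite mulnC -sum_nat_const; apply: eq_bigr => S SBC.
  have cS : #|S| = k.+2 by move: SBC; rewrite !inE => /andP[/andP[/eqP]].
  rewrite -(card_tuples_spanning cS) -sum1_card; apply: eq_bigl => t.
  by rewrite [RHS]inE; apply: andb_idl => /eqP tS; move: SBC; rewrite -tS.
apply/eqP; rewrite -(eqn_pmul2l (isT : (0 < k.+2)%N)) key factS; apply/eqP; ring.
Qed.

End Tessellation.

(** * The norm of the Neumann data of a volume form *)

Section Bounds.
Variables (R : realType) (n : nat) (Om : {fset 'rV[int]_n}).
Local Notation H := (tilde Om).
Variables (k : nat) (c : 'I_k.+1 -> 'I_n).
Hypothesis c_inj : injective c.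

(** A completion is encoded injectively by the set of coordinates outside the codomain of [c] where
    it is odd; [c] is injective, so [n - k - 1] coordinates remain. *)
Lemma card_signed_neighbours (t : k.+1.-tuple H) (e : int) : spans_clique t -> e != 0 ->
  (#|[set u : H | spans_clique [tuple of u :: t] &&
      (affine_vol c (fcons (pos u) (tpos t)) == e)]| <= 2 ^ (n - k - 1))%N.
Proof.
move=> st e0; set A := [set u | _].
pose C := [set i | i \notin codom c].
have cC : #|C| = (n - k - 1)%N.
  have -> : C = ~: [set i in codom c] by apply/finset.setP => i; rewrite !inE.
  by rewrite cardsCs finset.setCK cardsE card_codom // !card_ord; lia.
pose phi (u : H) := [set i in C | odd (absz (pos u 0 i))].
have phi_inj : {in A &, injective phi}.
  move=> u v; rewrite !inE => /andP[su /eqP eu] /andP[sv /eqP ev] /finset.setP E.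
  apply: val_inj; rewrite -!/(pos _).
  apply: (neighbour_inj (fun i j => spans_cmp i j st) ord0 (c := c)) => [j|j|||i ic].
  - exact: spans_cons_cmp.
  - exact: spans_cons_cmp.
  - by rewrite eu ev.
  - by rewrite eu.
  - by have := E i; rewrite !inE ic.
rewrite -(card_in_imset phi_inj) -cC -card_powerset; apply: subset_leq_card.
apply/fintype.subsetP => _ /imsetP[u _ ->]; rewrite powersetE.
by apply/fintype.subsetP => i; rewrite inE => /andP[].
Qed.

Let w : cochain R H k := vol_form R Om c.

Let head_interior (t : k.+2.-tuple H) : bool :=
  ([set x in t] \in bcliques H k.+2) && (thead t \notin bdry H).

(** For [t] in Ω the left side is zero. If [t] has a boundary vertex, every completion is interior
    and yields a clique with that single boundary vertex, so the right-hand sum counts all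
    completions. *)
Lemma cod_d_vol_form_sqr_le (t : k.+1.-tuple H) :
  cod (d w) t * cod (d w) t <=
  (2 ^ (n - k - 1))%:R * \sum_(u : H) (head_interior [tuple of u :: t])%:R.
Proof.
have rhs0 : 0 <= (2 ^ (n - k - 1))%:R * \sum_(u : H) (head_interior [tuple of u :: t])%:R
  :> R.
  by rewrite mulr_ge0 ?ler0n // sumr_ge0 // => u _; rewrite ler0n.
have wf : cod (d w) \in forms R H k by rewrite cod_forms ?d_forms // vol_form_forms.
have [st|nst] := boolP (spans_clique t); last by rewrite (form_off wf) // mul0r.
have [tO|] := boolP [forall i, tnth t i \notin bdry H].
  rewrite (_ : cod (d w) t = 0) ?mul0r //;
    apply: cod_d_vol_form_interior => // x /tnthP[i ->].
  by rewrite finset.in_setC; apply: (forallP tO).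
rewrite negb_forall => /existsP[j]; rewrite negbK => tj.
pose A (e : int) := [set u : H | spans_clique [tuple of u :: t] &&
      (affine_vol c (fcons (pos u) (tpos t)) == e)].
have hE u : head_interior [tuple of u :: t] = spans_clique [tuple of u :: t].
  apply/andP/idP => [[]|su]; first by rewrite inE => /andP[].
  have uB : u \notin bdry H.
    have := su; rewrite spans_cons => /andP[_ /forallP/(_ j)].
    by apply: contraL => uB; apply: tilde_bdry_indep.
  rewrite theadE; split=> //.
  rewrite inE -/(spans_clique [tuple of u :: t]) su.
  suff -> : [set x in u :: t] :&: bdry H = [set tnth t j] by rewrite cards1.
  apply/eqP; rewrite finset.eqEsubset; apply/andP; split; apply/fintype.subsetP => x;
    last first.
    move=> /set1P ->; apply/finset.setIP; split=> //.
    by rewrite inE in_cons mem_tnth orbT.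
  move=> /finset.setIP[]; rewrite inE in_cons => /orP[/eqP->|/tnthP[i ->] iB].
    by move=> uB'; rewrite uB' in uB.
  apply/set1P/eqP; rewrite -[_ == _]negbK; apply/negP => ij.
  have {}ij : i != j by apply: contraNneq ij => ->.
  have := spans_cliqueP _ st i j ij; apply/negP; exact: tilde_bdry_indep.
have zE : cod (d w) t = #|A 1|%:R - #|A (-1)|%:R.
  rewrite cod_d_vol_formE -!sum1_card !natr_sum [in RHS]big_mkcond.
  rewrite [X in _ - X]big_mkcond -sumrB rmorph_sum [LHS]big_mkcond.
  apply: eq_bigr => u _; rewrite !inE; case: (boolP (spans_clique _)) => //= [su|_];
    last by rewrite subrr.
  have := vol1_le1 c (fun i j => spans_cmp i j st) (fun j => spans_cons_cmp j su).
  case: eqP => [->|n1]; first by rewrite subr0.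
  case: eqP => [->|n2]; first by rewrite sub0r.
  move=> le1; have -> : affine_vol c (fcons (pos u) (tpos t)) = 0 by lia.
  by rewrite subrr.
have sE : (#|A 1%R| + #|A (-1)%R| <= #|[set u : H | spans_clique [tuple of u :: t]]|)%N.
  rewrite -cardsUI [X in (_ + X)%N](_ : _ = 0%N) ?addn0; last first.
    apply/eqP; rewrite cards_eq0; apply/eqP/finset.setP => u; rewrite !inE.
    by case: (spans_clique _); case: eqP => //= ->.
  by apply: subset_leq_card; apply/fintype.subsetP => u; rewrite !inE => /orP[]/andP[->].
have sumE : \sum_(u : H) (head_interior [tuple of u :: t])%:R =
    #|[set u : H | spans_clique [tuple of u :: t]]|%:R :> R.
  rewrite -sum1_card natr_sum [RHS]big_mkcond; apply: eq_bigr => u _.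
  by rewrite hE inE; case: ifP.
rewrite sumE zE.
have := card_signed_neighbours st (isT : (1 : int) != 0).
have := card_signed_neighbours st (isT : (-1 : int) != 0).
rewrite -/(A 1%R) -/(A (-1)%R); move: sE; set p := #|A 1|; set q := #|A _|; set g := #|_|.
move: (2 ^ _)%N => M sg qM pM.
(* [|p - q|] is at most [M] and at most [p + q], and [p + q] is at most the number [g] of
   completions. *)
apply: le_trans (_ : M%:R * (p + q)%:R <= _); last by rewrite ler_wpM2l ?ler0n // ler_nat.
have {}qM : q%:R <= M%:R :> R by rewrite ler_nat.
have {}pM : p%:R <= M%:R :> R by rewrite ler_nat.
have p0 : 0 <= p%:R :> R by rewrite ler0n.
have q0 : 0 <= q%:R :> R by rewrite ler0n.
by rewrite natrD; nra.
Qed.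

(** Summing over [t] counts ordered cliques with interior head, [(k + 1) (k + 1)!] per clique; the
    normalization of [ip] removes the factorial. *)
Lemma ip_cod_d_vol_form_le :
  ip (cod (d w)) (cod (d w)) <= k.+1%:R * 2 ^+ (n - k - 1) * #|bcliques H k.+2|%:R.
Proof.
have wf : cod (d w) \in forms R H k by rewrite cod_forms ?d_forms // vol_form_forms.
rewrite ip_formE //.
have -> : k.+1%:R * 2 ^+ (n - k - 1) * #|bcliques H k.+2|%:R =
    (k.+1)`!%:R^-1 * ((2 ^ (n - k - 1))%:R * (k.+1 * k.+1`! * #|bcliques H k.+2|)%:R) :> R.
  have f0 : (k.+1)`!%:R != 0 :> R by rewrite pnatr_eq0 -lt0n fact_gt0.
  rewrite natrX 2!natrM; move: (k.+1)`!%:R f0 k.+1%:R => f f0 K.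
  by field.
rewrite ler_wpM2l ?invr_ge0 ?ler0n //.
apply: le_trans (ler_sum _ (fun t _ => cod_d_vol_form_sqr_le t)) _.
rewrite -mulr_sumr ler_wpM2l ?ler0n // -card_bcliques_head -sum1_card natr_sum.
rewrite [leRHS]big_mkcond [leRHS]sum_cons_tuple [leRHS]exchange_big.
rewrite le_eqVlt; apply/orP; left; apply/eqP.
apply: eq_bigr => t _; apply: eq_bigr => u _; rewrite [in RHS]inE -/(head_interior _).
by case: ifP.
Qed.

End Bounds.

(** * Cliques with prescribed directions *)

Section PathSimplex.
Variables (n k : nat) (i0 : 'I_n).

(** [i0] is only the default of [nth], never reached when [I] has [k + 1] elements. *)
Definition coords (I : {set 'I_n}) (l : 'I_k.+1) : 'I_n := nth i0 (enum I) l.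

Lemma coords_inj (I : {set 'I_n}) : #|I| = k.+1 -> injective (coords I).
Proof.
move=> cI l l' /eqP; rewrite nth_uniq ?enum_uniq -?cardE ?cI // => /eqP.
exact: val_inj.
Qed.

Lemma codom_coords (I : {set 'I_n}) : #|I| = k.+1 -> codom (coords I) =i I.
Proof.
move=> cI i; apply/codomP/idP => [[l ->]|iI].
  by rewrite -mem_enum mem_nth // -cardE cI.
have il : (index i (enum I) < k.+1)%N by rewrite -cI cardE index_mem mem_enum.
by exists (Ordinal il); rewrite /coords /= nth_index // mem_enum.
Qed.

Definition path_vertex (x : 'rV[int]_n) (j : seq 'I_n) (i : 'I_k.+2) : 'rV[int]_n :=
  nth 0 (path_simplex x j) i.

(** Consecutive path vertices differ by a basis vector, so the step matrix has 0/1 entries recording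
    the directions. *)
Lemma affine_vol_path (c : 'I_k.+1 -> 'I_n) x j : size j = k.+1 ->
  affine_vol c (path_vertex x j) = \det (\matrix_(i, l) (c l == nth i0 j i)%:R).
Proof.
move=> sj; rewrite affine_vol_steps; congr (\det _); apply/matrixP => i l; rewrite !mxE.
have vE (a : 'I_k.+2) : path_vertex x j a = x + \sum_(l <- take a j) delta_mx 0 l.
  rewrite /path_vertex /path_simplex (nth_map 0%N) ?size_iota ?sj //.
  by rewrite nth_iota ?sj // add0n.
rewrite !vE /= /bump /= add1n (take_nth i0) ?sj // big_rcons /= !mxE.
by rewrite /= opprD addrACA subrr add0r addrAC subrr add0r.
Qed.

(** The matrix is a permutation matrix, hence orthogonal. *)
Lemma det_coords_neq0 (I : {set 'I_n}) (j : seq 'I_n) : #|I| = k.+1 -> perm_eq j (enum I) ->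
  \det (\matrix_(i < k.+1, l < k.+1) (coords I l == nth i0 j i)%:R) != 0 :> int.
Proof.
move=> cI jI; set E := \matrix_(i, l) _.
have sj : size j = k.+1 by rewrite (perm_size jI) -cardE.
have uj : uniq j by rewrite (perm_uniq jI) enum_uniq.
suff EE : E *m E^T = 1%:M.
  have := congr1 determinant EE; rewrite det_mulmx det_tr det1 => dd.
  by apply/eqP => d0; move: dd; rewrite d0 mul0r.
apply/matrixP => i i'; rewrite !mxE.
have /codomP[l ll] : nth i0 j i \in codom (coords I).
  by rewrite codom_coords // -mem_enum -(perm_mem jI) mem_nth // sj.
rewrite (bigD1 l) //= big1 => [|l' l'l]; rewrite !mxE.
  by rewrite -ll eqxx mul1r addr0 nth_uniq ?sj.
by rewrite ll (inj_eq (coords_inj cI)) (negbTE l'l) mul0r.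
Qed.

(** A direction of [I] missing from [J] produces a zero row. *)
Lemma det_coords_eq0 (I J : {set 'I_n}) (j : seq 'I_n) :
  #|I| = k.+1 -> #|J| = k.+1 -> I != J -> perm_eq j (enum I) ->
  \det (\matrix_(i < k.+1, l < k.+1) (coords J l == nth i0 j i)%:R) = 0 :> int.
Proof.
move=> cI cJ IJ jI.
have /subsetPn[a aI aJ] : ~~ (I \subset J).
  by apply: contra IJ => sIJ; rewrite eqEcard sIJ cI cJ leqnn.
have sj : size j = k.+1 by rewrite (perm_size jI) -cardE.
have aj : a \in j by rewrite (perm_mem jI) mem_enum.
have ai : (index a j < k.+1)%N by rewrite -sj index_mem.
rewrite (expand_det_row _ (Ordinal ai)) big1 // => l _; rewrite mxE /= nth_index //.
case: eqP => [la|_]; last by rewrite mul0r.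
by case/negP: aJ; rewrite -la -codom_coords // codom_f.
Qed.

End PathSimplex.

Section DirectedCliques.
Variables (R : realType) (n k : nat) (i0 : 'I_n) (Om : {fset 'rV[int]_n}).
Local Notation H := (tilde Om).
Local Notation coords := (@coords n k i0).

(** Up to order the vertices of [t] form a model path, so its volume is, up to sign, one of the
    determinants above. *)
Lemma dir_clique_affine_vol (I J : {set 'I_n}) (t : k.+2.-tuple H) :
  #|I| = k.+1 -> #|J| = k.+1 -> [set x in t] \in dir_cliques Om I ->
  spans_clique t /\ (affine_vol (coords J) (tpos t) == 0) = (I != J).
Proof.
move=> cI cJ; rewrite inE cI => /andP[st /existsP[x /existsP[j /andP[jI pj]]]].
have {}st : spans_clique t by [].
split=> //.
have sj : size j = k.+1 by rewrite size_tuple.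
have sp : size (path_simplex (pos x) j) == k.+2 by rewrite size_map size_iota sj.
have tp : perm_eq (map (@pos n Om) t) (Tuple sp).
  apply: perm_trans pj; apply: perm_map; apply: uniq_perm => [||u].
  - exact: spans_uniq st.
  - exact: enum_uniq.
  - by rewrite mem_enum inE.
have /tuple_permP[s sE] := tp.
have tE : tpos t = path_vertex (pos x) j \o s.
  apply/funext => i; have := congr1 (fun q => nth 0 q i) sE.
  rewrite (nth_map (thead t)) ?size_tuple // -tnth_nth => E.
  rewrite -[LHS]/(pos (tnth t i)) E.
  by rewrite -[LHS](tnth_nth 0 [tuple tnth (Tuple sp) (s i) | i < k.+2]) tnth_mktuple
    (tnth_nth 0).
rewrite tE affine_vol_perm mulf_eq0 signr_eq0 /= (affine_vol_path i0) //.
have [<-|IJ] := eqVneq I J; first by apply/negbTE/det_coords_neq0.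
by rewrite (det_coords_eq0 i0 cI cJ IJ jI) eqxx.
Qed.

(** An ordered clique belongs to at most one direction set. There a single summand survives, and its
    volume is a nonzero integer, so its square is at least 1. The [(k + 2)!] orderings of each
    clique cancel the normalization of [ip]; all other tuples contribute nonnegatively. *)
Lemma energy_lower_bound m (J : 'I_m -> {set 'I_n}) (x : 'I_m -> R) :
  injective J -> (forall i, #|J i| = k.+1) ->
  \sum_i #|dir_cliques Om (J i)|%:R * x i ^+ 2 <=
    ip (\sum_i x i *: d (vol_form R Om (coords (J i))))
       (\sum_i x i *: d (vol_form R Om (coords (J i)))).
Proof.
move=> Jinj cJ; set g := \sum_i x i *: _.
have gf : g \in forms R H k.+1.
  by apply: memv_suml => i _; rewrite memvZ // d_forms // vol_form_forms.
have f0 : (k.+2)`!%:R != 0 :> R by rewrite pnatr_eq0 -lt0n fact_gt0.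
rewrite ip_formE // -[leLHS](mulKf f0) ler_wpM2l ?invr_ge0 ?ler0n // mulr_sumr.
apply: le_trans (_ : \sum_(t : k.+2.-tuple H) \sum_i
    ([set y in t] \in dir_cliques Om (J i))%:R * x i ^+ 2 <= _).
  rewrite exchange_big /= le_eqVlt; apply/orP; left; apply/eqP; apply: eq_bigr => i _.
  rewrite mulrA -natrM -mulr_suml; congr (_ * _); rewrite -natr_sum; congr _%:R.
  rewrite -big_mkcond /=.
  rewrite (partition_big (fun t : k.+2.-tuple H => [set y in t]) (mem (dir_cliques Om (J
    i)))) //=.
  rewrite mulnC -sum_nat_const; apply: eq_bigr => S SC.
  have cS : #|S| = k.+2 by move: SC; rewrite !inE cJ => /andP[/andP[/eqP]].
  rewrite -(card_tuples_spanning cS) -sum1_card; apply: eq_bigl => t.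
  by rewrite inE; apply/esym/andb_idl => /eqP tS; move: SC; rewrite -tS.
apply: ler_sum => t _.
case: (pickP (fun i => [set y in t] \in dir_cliques Om (J i))) => [i ti|none]; last first.
  by rewrite big1 => [|i _]; rewrite ?none ?mul0r // -expr2 sqr_ge0.
have vE l := dir_clique_affine_vol (cJ i) (cJ l) ti.
have st : spans_clique t by have [] := vE i.
have other l : l != i -> affine_vol (coords (J l)) (tpos t) = 0.
  by move=> li; apply/eqP; rewrite (vE l).2 (inj_eq Jinj) eq_sym.
have gE : g t = x i * (affine_vol (coords (J i)) (tpos t))%:~R.
  rewrite sum_ffunE (bigD1 i) //= big1 => [|l li]; rewrite ffunE d_vol_formE //.
    by rewrite addr0.
  by rewrite other // scaler0.
rewrite (bigD1 i) //= big1 ?addr0 => [|l li]; last first.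
  case: (boolP (_ \in _)) => [tl|_]; last by rewrite mul0r.
  have := (dir_clique_affine_vol (cJ l) (cJ l) tl).2; rewrite other // !eqxx.
  by [].
rewrite ti mul1r gE -expr2 exprMn ler_peMr ?sqr_ge0 //.
have := (vE i).2; rewrite eqxx /= => /negbT v0.
rewrite -rmorphXn /= -[1]/(1%:~R) ler_int; move: v0; set v := affine_vol _ _; nia.
Qed.

End DirectedCliques.

Lemma bigminn_le (T : finType) (P : pred T) (F : T -> nat) (z : nat) i :
  P i -> (\big[minn/z]_(j | P j) F j <= F i)%N.
Proof.
move=> Pi; rewrite -big_filter; have : i \in [seq j <- index_enum T | P j].
  by rewrite mem_filter Pi mem_index_enum.
elim: [seq _ <- _ | _] => // a s IH; rewrite in_cons big_cons => /orP[/eqP->|/IH].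
  exact: geq_minl.
by apply: leq_trans; apply: geq_minr.
Qed.

Lemma bigminn_gt0 (T : finType) (P : pred T) (F : T -> nat) (z : nat) :
  (0 < z)%N -> (forall i, P i -> (0 < F i)%N) -> (0 < \big[minn/z]_(j | P j) F j)%N.
Proof.
move=> z0 F0; elim/big_ind: _ => // a b a0 b0; by rewrite leq_min a0 b0.
Qed.

(** * Summation over the sets of directions *)

Section DirectionBounds.
Variables (R : realType) (n k : nat) (Om : {fset 'rV[int]_n}).
Hypotheses (hk : (k < n)%N)
  (hC : forall I : {set 'I_n}, #|I| = k.+1 -> dir_cliques Om I != finset.set0).
Local Notation H := (tilde Om).

Lemma direction_bound_le_min :
  k.+1%:R * 2 ^+ (n - k - 1) *
    \sum_(I : {set 'I_n} | #|I| == k.+1) #|bcliques H k.+2|%:R / #|dir_cliques Om I|%:R <=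
  n%:R * 'C(n.-1, k)%:R * 2 ^+ (n - k - 1) * #|bcliques H k.+2|%:R /
    (min_dir_cliques Om k)%:R :> R.
Proof.
set b : R := #|_|%:R; set P : R := 2 ^+ _; set mn := min_dir_cliques Om k.
have cardA : #|[pred I : {set 'I_n} | #|I| == k.+1]| = 'C(n, k.+1).
  by rewrite -[in RHS](card_ord n) -card_draws; apply: eq_card => I; rewrite !inE.
have C0 (I : {set 'I_n}) : #|I| == k.+1 -> (0 < #|dir_cliques Om I|)%N.
  by move=> /eqP/hC; rewrite card_gt0.
(* The neutral element of the minimum must be positive too: [k < n] provides some [I], and its
   directed cliques are among all [(k + 2)]-cliques. *)
have mn0 : (0 < mn)%N.
  apply: bigminn_gt0 => //.
  have /card_gt0P[I] : (0 < #|[pred I : {set 'I_n} | #|I| == k.+1]|)%N.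
    by rewrite cardA bin_gt0.
  rewrite inE => cI; have := C0 I cI; rewrite !card_gt0 => /set0Pn[S].
  by rewrite inE (eqP cI) => /andP[SC _]; apply/set0Pn; exists S.
apply: le_trans (_ : k.+1%:R * P * \sum_(I : {set 'I_n} | #|I| == k.+1) (b / mn%:R) <= _).
  rewrite ler_wpM2l ?mulr_ge0 ?ler0n ?exprn_ge0 //.
  apply: ler_sum => I cI; rewrite ler_wpM2l ?ler0n // lef_pV2 ?posrE ?ltr0n ?C0 //.
  by rewrite ler_nat; apply: bigminn_le.
rewrite sumr_const cardA -[(b / _) *+ _]mulr_natl.
(* The identity [n C(n-1, k) = (k+1) C(n, k+1)] explains the constant of the weaker bound. *)
have -> : n%:R * 'C(n.-1, k)%:R = k.+1%:R * 'C(n, k.+1)%:R :> R.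
  by rewrite -!natrM mul_bin_diag.
by rewrite le_eqVlt; apply/orP; left; apply/eqP; ring.
Qed.

(** The hypothesis on [T] is what [T_dd_sum_lambda_le] and [T_lap_sum_lambda_le] provide for volume
    forms, so both operators are treated at once. *)
Lemma direction_bound (T : 'End(subvs_of (bforms R H k))) :
  (forall m (w : 'I_m -> cochain R H k) (D : 'I_m -> R) (c : 'I_m -> 'I_k.+1 -> 'I_n),
    (forall i, w i = vol_form R Om (c i)) -> (forall i, 0 < D i) ->
    (forall x : 'I_m -> R, \sum_i D i * x i ^+ 2 <=
       ip (\sum_i x i *: d (w i)) (\sum_i x i *: d (w i))) ->
    (m <= size (pos_eigenvalues T))%N /\
    \sum_(i < m) lambda T i <= \sum_i ip (cod (d (w i))) (cod (d (w i))) / D i) ->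
  ('C(n, k.+1) <= size (pos_eigenvalues T))%N /\
  \sum_(i < 'C(n, k.+1)) lambda T i <= k.+1%:R * 2 ^+ (n - k - 1) *
    \sum_(I : {set 'I_n} | #|I| == k.+1) #|bcliques H k.+2|%:R / #|dir_cliques Om I|%:R.
Proof.
move=> TP; pose A := [set I : {set 'I_n} | #|I| == k.+1].
have <- : #|A| = 'C(n, k.+1) by rewrite card_draws card_ord.
pose i0 : 'I_n := Ordinal (leq_ltn_trans (leq0n k) hk).
pose J (i : 'I_#|A|) : {set 'I_n} := enum_val i.
have cJ i : #|J i| = k.+1 by have := enum_valP i; rewrite inE => /eqP.
pose c i := @coords n k i0 (J i).
have D0 i : 0 < #|dir_cliques Om (J i)|%:R :> R by rewrite ltr0n card_gt0 hC.
have [sz le] := TP _ _ _ c (fun=> erefl) D0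
  (fun x => energy_lower_bound i0 Om x (@enum_val_inj _ A) cJ).
split=> //; apply: le_trans le _; rewrite mulr_sumr.
rewrite [leRHS](eq_bigl (fun I => I \in A)) => [|I]; last by rewrite inE.
rewrite [leRHS]big_enum_val /=; apply: ler_sum => i _.
rewrite mulrA ler_pM2r ?invr_gt0 //; apply: ip_cod_d_vol_form_le.
exact: coords_inj.
Qed.

End DirectionBounds.

Theorem theorem5p2 (R : realType) (n k : nat) (Om : {fset 'rV[int]_n})
    (hk : (k < n)%N) (hOm : Om != fset0)
    (hC : forall I : {set 'I_n}, #|I| = k.+1 -> dir_cliques Om I != finset.set0) :
  let N := 'C(n, k.+1) in
  let H := tilde Om in
  let bound : R :=
    k.+1%:R * 2 ^+ (n - k - 1) *
      \sum_(I : {set 'I_n} | #|I| == k.+1)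
         #|bcliques H k.+2|%:R / #|dir_cliques Om I|%:R in
  let bound' : R :=
    n%:R * 'C(n.-1, k)%:R * 2 ^+ (n - k - 1) * #|bcliques H k.+2|%:R /
      (min_dir_cliques Om k)%:R in
  [/\ (N <= size (pos_eigenvalues (T_dd R H k)))%N,
      (N <= size (pos_eigenvalues (T_lap R H k)))%N,
      \sum_(i < N) lambda (T_dd R H k) i <= bound,
      \sum_(i < N) lambda (T_lap R H k) i <= bound &
      \sum_(i < N) lambda (T_dd R H k) i <= bound' /\
      \sum_(i < N) lambda (T_lap R H k) i <= bound'].
Proof.
move=> N H bound bound'.
have bb : bound <= bound' by exact: direction_bound_le_min.
have indep := @tilde_bdry_indep n Om.
have [s1 l1] : (N <= size (pos_eigenvalues (T_dd R H k)))%N /\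
    \sum_(i < N) lambda (T_dd R H k) i <= bound.
  apply: direction_bound => // m w D c wE D0 Dle.
  apply: T_dd_sum_lambda_le => // i; rewrite wE; first exact: vol_form_forms.
  exact: cod_d_vol_form_interior.
have [s2 l2] : (N <= size (pos_eigenvalues (T_lap R H k)))%N /\
    \sum_(i < N) lambda (T_lap R H k) i <= bound.
  move: (s1) (l1); rewrite /N /bound /H; case: (k) hk hC => [|k'] hk' hC' s1' l1'.
    by rewrite T_lap0.
  apply: direction_bound => // m w D c wE D0 Dle.
  apply: T_lap_sum_lambda_le => // i; rewrite wE.
  - exact: vol_form_forms.
  - exact: cod_vol_form_interior.
  - exact: cod_d_vol_form_interior.
by split=> //; split; apply: le_trans bb.
Qed.
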